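(* Let $n\ge 1$ and let $\mathfrak g$ be an affine Kac-Moody algebra of type $A_n^{(1)}$ with set of positive roots $\Delta^+$. Then $$\prod_{\alpha \in \Delta^+} \left( \frac{1-q^{-1}\boldsymbol z^{\alpha}}{1-\boldsymbol z^{\alpha}} \right)^{\operatorname{mult}(\alpha)} = \sum_{Y \in \mathcal Y(\infty)} (1-q^{-1})^{\mathscr N(Y)}\,\boldsymbol z^{-\mathrm{wt}(Y)},$$ where $\mathcal Y(\infty)$ is the set of reduced proper generalized Young walls of type $A_n^{(1)}$ and $\mathscr N(Y)$ is the statistic defined in the context.
   Context: **Roots.** $I=\{0,1,\dots,n\}$, $\alpha_i$ ($i\in I$) are the simple roots, $\delta=\alpha_0+\cdots+\alpha_n$. $\Delta_{\mathrm{cl}}^+=\{\alpha_i+\cdots+\alpha_j:1\le i\le j\le n\}$, $\Delta_{\mathrm{cl}}=\pm\Delta_{\mathrm{cl}}^+$. The positive roots are $\Delta^+=\Delta^+_{\mathrm{re}}\sqcup\Delta^+_{\mathrm{im}}$ with $\Delta^+_{\mathrm{re}}=\{\alpha+m\delta:\alpha\in\Delta_{\mathrm{cl}},m\in\mathbf Z_{>0}\}\cup\Delta_{\mathrm{cl}}^+$ and $\Delta^+_{\mathrm{im}}=\{m\delta:m\in\mathbf Z_{>0}\}$; $\operatorname{mult}(\alpha)=1$ for real $\alpha$ and $\operatorname{mult}(m\delta)=n$. The symbols $\boldsymbol z^{\alpha}$ are formal exponentials ($\boldsymbol z^{\alpha+\beta}=\boldsymbol z^\alpha\boldsymbol z^\beta$),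 and the identity is one of formal power series in $\boldsymbol z^{\alpha_0},\dots,\boldsymbol z^{\alpha_n}$. **Generalized Young walls.** The board has rows numbered $1,2,3,\dots$ from bottom to top and columns numbered $1,2,3,\dots$ from right to left; the site in row $j$ and column $i$ has color $j-i \bmod (n+1)$, an element of $I$. A generalized Young wall is a finite collection of boxes placed on sites of the board, each colored by the color of its site, such that in each row the boxes are stacked from right to left without gaps. So $Y$ is determined by the numbers $N_k(Y)$ of boxes in its $k$th row ($k\ge1$). Its weight is $\mathrm{wt}(Y)=-\sum_{i\in I}m_i(Y)\alpha_i$, where $m_i(Y)$ is the number of $i$-colored boxes. $Y$ is proper if $N_k(Y)\le N_\ell(Y)$ whenever $k>\ell$ and $k\equiv\ell \bmod (n+1)$. Let $a_i(k)$ be the number of $i$-colored boxes in the $k$th column $Y_k$. The column $Y_k$ contains a removable $\delta$ if one may remove one $i$-colored box for every $i\in I$ from $Y_k$ and still obtain a generalized Young wall, i.e. if $a_{i-1}(k+1)<a_i(k)$ for all $i\in I$ (indices mod $n+1$). $Y$ is reduced if no column contains a removable $\delta$. $\mathcal Y(\infty)$ is the set of all reduced proper generalized Young walls. **The statistic $\mathscr N(Y)$.** For $1\le j\le n+1$ let $S_j(Y)=\bigcup_{m\ge0}\{N_{(n+1)m+j}(Y)\}$ (a set of distinct values). For $m\ge0$ write $N_{(n+1)(m+1)}(Y)=(n+1)^{p_m}q_m$ with $p_m\ge 0$ and $q_m$ not divisible by $n+1$; if $N_{(n+1)(m+1)}(Y)=0$ put $(p_m,q_m)=(0,0)$. Set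 $$\mathscr Q(Y)=\Big(\bigcup_{m\ge0}\{(n+1)^sq_m:s=0,1,\dots,p_m-1\}\Big)\cup\{0\},\qquad \mathscr P(Y)=\sum_{t\ge1,\ (n+1)\nmid t}\max\{p_m:q_m=t,\ m\ge0\},$$ where the maximum of the empty set is $0$. Then $$\mathscr N(Y)=n\,\mathscr P(Y)+\sum_{j=1}^{n+1}\#\big(S_j(Y)\setminus\mathscr Q(Y)\big).$$ *)

(* Defs.v *)
From HB Require Import structures.
From mathcomp Require Import all_boot all_order all_algebra finmap.
From mathcomp Require Import boolp classical_sets functions cardinality fsbigop.
From mathcomp Require Import mpoly.

Set Implicit Arguments.
Unset Strict Implicit.
Unset Printing Implicit Defensive.

Import GRing.Theory.
Local Open Scope classical_set_scope.
Local Open Scope ring_scope.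

Definition mfps (n : nat) (R : Type) : Type := 'X_{1..n} -> R.

Section MfpsZmod.
Variables (n : nat) (R : zmodType).
HB.instance Definition _ := GRing.Zmodule.copy (mfps n R) ('X_{1..n} -> R).
End MfpsZmod.

Section MfpsRing.
Variables (n : nat) (R : comNzRingType).
Implicit Types (f g h : mfps n R) (m : 'X_{1..n}) (d : nat).

Definition mfps_one : mfps n R := fun m => (m == 0%MM)%:R.

(* Cauchy product; the degree bound only makes the index type finite. *)
Definition mfps_mul f g : mfps n R := fun m =>
  \sum_(k : 'X_{1..n < (mdeg m).+1, (mdeg m).+1} | m == (k.1 + k.2)%MM)
    f k.1 * g k.2.

Definition mfps_scale (a : R) f : mfps n R := fun m => a * f m.

(* Truncation to total degree < d; it reduces the ring laws to {mpoly R[n]}. *)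
Definition mfps_trunc d f : {mpoly R[n]} :=
  \sum_(m : 'X_{1..n < d}) (f m *: 'X_[m]).

Lemma coef_mfps_trunc d f m : (mdeg m < d)%N -> (mfps_trunc d f)@_m = f m.
Proof. by move=> md; rewrite /mfps_trunc mcoeff_mpoly. Qed.

Lemma mcoeffM_eq (p p' q q' : {mpoly R[n]}) m :
  (forall k, (mdeg k <= mdeg m)%N -> p@_k = p'@_k) ->
  (forall k, (mdeg k <= mdeg m)%N -> q@_k = q'@_k) ->
  (p * q)@_m = (p' * q')@_m.
Proof.
move=> ep eq; rewrite !mcoeffM; apply: eq_bigr => k _.
by rewrite ep ?eq // -ltnS bmdeg.
Qed.

Lemma mfps_mulE d f g m : (mdeg m < d)%N ->
  mfps_mul f g m = (mfps_trunc d f * mfps_trunc d g)@_m.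
Proof.
move=> md; rewrite mcoeffM; apply: eq_bigr => k _.
by rewrite !coef_mfps_trunc // (leq_trans (bmdeg _)).
Qed.

Lemma mfps_mulA : associative mfps_mul.
Proof.
move=> f g h; apply: funext => m; have md := ltnSn (mdeg m).
rewrite !(mfps_mulE _ _ md).
transitivity ((mfps_trunc (mdeg m).+1 f *
   (mfps_trunc (mdeg m).+1 g * mfps_trunc (mdeg m).+1 h))@_m).
  apply: mcoeffM_eq => // k km.
  by rewrite coef_mfps_trunc ?ltnS // -mfps_mulE ?ltnS.
rewrite mulrA; apply: mcoeffM_eq => // k km.
by rewrite coef_mfps_trunc ?ltnS // -mfps_mulE ?ltnS.
Qed.

Lemma mfps_mulC : commutative mfps_mul.
Proof.
move=> f g; apply: funext => m; have md := ltnSn (mdeg m).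
by rewrite !(mfps_mulE _ _ md) mulrC.
Qed.

Lemma mfps_mul1 : left_id mfps_one mfps_mul.
Proof.
move=> f; apply: funext => m; have md := ltnSn (mdeg m).
rewrite (mfps_mulE _ _ md) -[RHS](coef_mfps_trunc f md) -[in RHS](mul1r (mfps_trunc _ f)).
apply: mcoeffM_eq => // k km.
by rewrite coef_mfps_trunc ?ltnS // mcoeff1.
Qed.

Lemma mfps_mulDl : left_distributive mfps_mul +%R.
Proof.
move=> f g h; apply: funext => m.
rewrite /mfps_mul -[RHS]big_split /=; apply: eq_bigr => k _.
exact: mulrDl.
Qed.

Lemma mfps_one_neq0 : mfps_one != 0.
Proof.
apply/eqP => /(congr1 (fun f : mfps n R => f 0%MM)).
by rewrite /mfps_one eqxx => /eqP; rewrite oner_eq0.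
Qed.

HB.instance Definition _ := GRing.Zmodule_isComNzRing.Build (mfps n R)
  mfps_mulA mfps_mulC mfps_mul1 mfps_mulDl mfps_one_neq0.

Lemma mfps_scaleA a b f :
  mfps_scale a (mfps_scale b f) = mfps_scale (a * b) f.
Proof. by apply: funext => m; rewrite /mfps_scale mulrA. Qed.

Lemma mfps_scale1 : left_id 1 mfps_scale.
Proof. by move=> f; apply: funext => m; rewrite /mfps_scale mul1r. Qed.

Lemma mfps_scaleDr : right_distributive mfps_scale +%R.
Proof. by move=> a f g; apply: funext => m; apply: mulrDr. Qed.

Lemma mfps_scaleDl f : {morph mfps_scale^~ f : a b / a + b}.
Proof. by move=> a b; apply: funext => m; apply: mulrDl. Qed.

HB.instance Definition _ := GRing.Zmodule_isLmodule.Build R (mfps n R)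
  mfps_scaleA mfps_scale1 mfps_scaleDr mfps_scaleDl.

Lemma mfps_coef0 m : (0 : mfps n R) m = 0. Proof. by []. Qed.
Lemma mfps_coef1 m : (1 : mfps n R) m = (m == 0%MM)%:R. Proof. by []. Qed.
Lemma mfps_coefD f g m : (f + g) m = f m + g m. Proof. by []. Qed.
Lemma mfps_coefN f m : (- f) m = - f m. Proof. by []. Qed.
Lemma mfps_coefB f g m : (f - g) m = f m - g m. Proof. by []. Qed.
Lemma mfps_coefZ (a : R) f m : (a *: f) m = a * f m. Proof. by []. Qed.
Lemma mfps_coefM f g m : (f * g) m =
  \sum_(k : 'X_{1..n < (mdeg m).+1, (mdeg m).+1} | m == (k.1 + k.2)%MM)
    f k.1 * g k.2.
Proof. by []. Qed.

Lemma mfps_scaleAl (a : R) f g : a *: (f * g) = (a *: f) * g.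
Proof.
apply: funext => m; rewrite mfps_coefZ !mfps_coefM mulr_sumr.
by apply: eq_bigr => k _; rewrite mfps_coefZ mulrA.
Qed.

HB.instance Definition _ :=
  GRing.Lmodule_isLalgebra.Build R (mfps n R) mfps_scaleAl.
HB.instance Definition _ := GRing.Lalgebra_isComAlgebra.Build R (mfps n R).

Lemma mfps_coef_sum (I : Type) (r : seq I) (P : pred I) (F : I -> mfps n R) m :
  (\sum_(i <- r | P i) F i) m = \sum_(i <- r | P i) F i m.
Proof. by elim/big_rec2: _ => // i y x _ <-. Qed.

Lemma mfps_coefM_eq f f' g g' m :
  (forall k, (mdeg k <= mdeg m)%N -> f k = f' k) ->
  (forall k, (mdeg k <= mdeg m)%N -> g k = g' k) ->
  (f * g) m = (f' * g') m.
Proof.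
move=> ef eg; rewrite !mfps_coefM; apply: eq_bigr => k _.
by rewrite ef ?eg // -ltnS bmdeg.
Qed.

Lemma mfps_coefM0 f g : (f * g) 0%MM = f 0%MM * g 0%MM.
Proof.
rewrite -[LHS]/(mfps_mul f g 0%MM) (@mfps_mulE 1) ?mdeg0 //.
by rewrite (rmorphM (mcoeff 0%MM)) /= !coef_mfps_trunc ?mdeg0.
Qed.

Lemma mfps_coefX_small f k m :
  f 0%MM = 0 -> (mdeg m < k)%N -> (f ^+ k) m = 0.
Proof.
move=> f0; elim: k m => // k IH m mk; rewrite exprS mfps_coefM.
apply: big1 => -[k1 k2] /= /eqP mE.
have [k1d|k1d] := posnP (mdeg k1).
  by move/eqP: k1d; rewrite mdeg_eq0 => /eqP ->; rewrite f0 mul0r.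
rewrite IH ?mulr0 //; rewrite mE mdegD ltnS in mk.
by apply: leq_trans mk; rewrite -{1}[mdeg k2]add0n ltn_add2r.
Qed.

End MfpsRing.

Section MfpsUnit.
Variables (n : nat) (R : comUnitRingType).
Implicit Types (f g : mfps n R) (m : 'X_{1..n}).

Definition mfps_unit : pred (mfps n R) := fun f => f 0%MM \is a GRing.unit.

(* With c the constant coefficient of f, the inverse is c^-1 times the
   geometric series in 1 - c^-1 f, cut off degree by degree. *)
Definition mfps_inv f : mfps n R :=
  if mfps_unit f then
    fun m => (f 0%MM)^-1 *
      (\sum_(k < (mdeg m).+1) (1 - (f 0%MM)^-1 *: f) ^+ k) m
  else f.

Lemma mfps_mulVr : {in mfps_unit, left_inverse 1 mfps_inv *%R}.
Proof.
move=> f uf; rewrite /mfps_inv; have uf' : mfps_unit f by []; rewrite uf'.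
set c := f 0%MM; set h := 1 - c^-1 *: f.
have h0 : h 0%MM = 0.
  by rewrite /h mfps_coefB mfps_coefZ mfps_coef1 eqxx mulVr ?subrr.
have fE : f = c *: (1 - h).
  by rewrite /h opprB addrC subrK scalerA divrr // scale1r.
apply: funext => m.
transitivity ((c^-1 *: (\sum_(k < (mdeg m).+1) h ^+ k) * f) m).
  apply: mfps_coefM_eq => // k km; rewrite mfps_coefZ; congr (_ * _).
  rewrite !mfps_coef_sum -!(big_mkord xpredT (fun i => (h ^+ i) k)).
  rewrite [RHS](big_cat_nat (n := (mdeg k).+1)) //=.
  rewrite [X in _ = (_ + X)%R]big_nat_cond [X in _ = (_ + X)%R]big1 ?addr0 //.
  by move=> i /andP[/andP[ki _] _]; rewrite mfps_coefX_small.
rewrite [in X in X m]fE -scalerAr -scalerAl scalerA divrr // scale1r.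
rewrite mulrC -(opprB h) mulNr -subrX1 opprB mfps_coefB.
by rewrite mfps_coefX_small // subr0.
Qed.

Lemma mfps_unitPl f g : g * f = 1 -> mfps_unit f.
Proof.
move=> /(congr1 (fun h : mfps n R => h 0%MM)).
rewrite mfps_coefM0 mfps_coef1 eqxx => gf.
by apply/unitrP; exists (g 0%MM); rewrite gf mulrC gf.
Qed.

Lemma mfps_invr_out : {in [predC mfps_unit], mfps_inv =1 id}.
Proof. by move=> f; rewrite inE /mfps_inv => /negP; case: ifP. Qed.

HB.instance Definition _ := GRing.ComNzRing_hasMulInverse.Build (mfps n R)
  mfps_mulVr mfps_unitPl mfps_invr_out.

End MfpsUnit.

(* The net of finite partial sums (products) over A converges to f
   coefficientwise, R being discrete. *)
Definition has_mfsum (n : nat) (R : comNzRingType) (K : choiceType)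
    (A : set K) (F : K -> mfps n R) (f : mfps n R) : Prop :=
  forall m : 'X_{1..n}, exists2 J0 : {fset K}, [set` J0] `<=` A &
    forall J : {fset K}, (J0 `<=` J)%fset -> [set` J] `<=` A ->
      (\sum_(x <- J) F x) m = f m.

Definition has_mfprod (n : nat) (R : comNzRingType) (K : choiceType)
    (A : set K) (F : K -> mfps n R) (f : mfps n R) : Prop :=
  forall m : 'X_{1..n}, exists2 J0 : {fset K}, [set` J0] `<=` A &
    forall J : {fset K}, (J0 `<=` J)%fset -> [set` J] `<=` A ->
      (\prod_(x <- J) F x) m = f m.

Lemma has_mfsum_unique n (R : comNzRingType) (K : choiceType) (A : set K)
  (F : K -> mfps n R) f g : has_mfsum A F f -> has_mfsum A F g -> f = g.
Proof.
move=> Ff Fg; apply: funext => m.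
have [J JA fE] := Ff m; have [L LA gE] := Fg m.
have JLA : [set` (J `|` L)%fset] `<=` A.
  by move=> x /=; rewrite in_fsetU => /orP[/JA|/LA].
by rewrite -(fE _ (fsubsetUl J L) JLA) -(gE _ (fsubsetUr J L) JLA).
Qed.

Lemma has_mfprod_unique n (R : comNzRingType) (K : choiceType) (A : set K)
  (F : K -> mfps n R) f g : has_mfprod A F f -> has_mfprod A F g -> f = g.
Proof.
move=> Ff Fg; apply: funext => m.
have [J JA fE] := Ff m; have [L LA gE] := Fg m.
have JLA : [set` (J `|` L)%fset] `<=` A.
  by move=> x /=; rewrite in_fsetU => /orP[/JA|/LA].
by rewrite -(fE _ (fsubsetUl J L) JLA) -(gE _ (fsubsetUr J L) JLA).
Qed.

Definition rootlat (n : nat) : Type := {ffun 'I_n.+1 -> int}.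
HB.instance Definition _ n :=
  GRing.Zmodule.copy (rootlat n) {ffun 'I_n.+1 -> int}.

Section Roots.
Variable n : nat.

Definition simple_root (i : 'I_n.+1) : rootlat n := [ffun k => (k == i)%:R].

Definition delta_root : rootlat n := \sum_(i < n.+1) simple_root i.

Definition cl_pos_root : set (rootlat n) :=
  [set a | exists i j : nat, [/\ (1 <= i)%N, (i <= j)%N, (j <= n)%N &
             a = \sum_(k < n.+1 | (i <= k <= j)%N) simple_root k]].

Definition cl_root : set (rootlat n) :=
  cl_pos_root `|` [set - a | a in cl_pos_root].

Definition re_pos_root : set (rootlat n) :=
  [set b | exists2 a, cl_root a &
             exists2 m : nat, (0 < m)%N & b = a + delta_root *+ m] `|` cl_pos_root.

Definition im_pos_root : set (rootlat n) :=
  [set b | exists2 m : nat, (0 < m)%N & b = delta_root *+ m].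

Definition pos_root : set (rootlat n) := re_pos_root `|` im_pos_root.

Definition root_mult (a : rootlat n) : nat := if `[< im_pos_root a >] then n else 1%N.

Definition rootlat_of_mnm (m : 'X_{1..n.+1}) : rootlat n :=
  [ffun i => Posz (m i)].

(* The series in the variables z^(alpha_0), ..., z^(alpha_n) whose only nonzero
   coefficient is 1 at a; it is 0 when a has a negative coordinate. *)
Definition zexp (R : comNzRingType) (a : rootlat n) : mfps n.+1 R :=
  fun m => (rootlat_of_mnm m == a)%:R.

Lemma rootlat_of_mnm_inj : injective rootlat_of_mnm.
Proof.
by move=> m m' /ffunP e; apply/mnmP => i; have := e i; rewrite !ffunE => -[].
Qed.

Lemma deltaE i : delta_root i = 1.
Proof.
rewrite /delta_root sum_ffunE (bigD1 i) //= big1 ?addr0; first by rewrite ffunE eqxx.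
by move=> k ki; rewrite ffunE eq_sym (negbTE ki).
Qed.

Lemma cl_pos_rootE a : cl_pos_root a -> forall i, a i = 0 \/ a i = 1.
Proof.
move=> [i [j [_ _ _ ->]]] k; rewrite sum_ffunE.
have [kij|kij] := boolP (i <= k <= j)%N; [right|left].
  rewrite (bigD1 k) //= big1 ?addr0; first by rewrite ffunE eqxx.
  by move=> l /andP[_ lk]; rewrite ffunE eq_sym (negbTE lk).
apply: big1 => l lij; rewrite ffunE; case: eqP => // kl.
by rewrite kl lij in kij.
Qed.

Lemma pos_root_mnm a : pos_root a -> exists m, a = rootlat_of_mnm m.
Proof.
have pos (b : rootlat n) : (forall i, exists k : nat, b i = Posz k) ->
    exists m, b = rootlat_of_mnm m.
  move=> bP; exists [multinom absz (b i) | i < n.+1].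
  by apply/ffunP => i; rewrite ffunE mnmE; have [k ->] := bP i.
have dE m (i : 'I_n.+1) : (delta_root *+ m) i = Posz m.
  by rewrite ffunMnE deltaE -natz.
case=> [[[b clb [m m0 ->]]|cla]|[m _ ->]]; apply: pos => i; last by exists m; rewrite dE.
- rewrite ffunE dE; case: m m0 => // m _.
  case: clb => [/cl_pos_rootE/(_ i)|[c /cl_pos_rootE/(_ i) ci <-]].
    by case=> ->; eexists; rewrite -PoszD.
  by rewrite ffunE; case: ci => ->; [exists m.+1|exists m; rewrite intS addrA addNr add0r].
- by case: (cl_pos_rootE cla i) => ->; [exists 0%N|exists 1%N].
Qed.

Lemma pos_root_neq0 a : pos_root a -> a != 0.
Proof.
have dE m (i : 'I_n.+1) : (delta_root *+ m) i = Posz m.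
  by rewrite ffunMnE deltaE -natz.
have cl0 b : cl_pos_root b -> b ord0 = 0.
  move=> [i [j [i0 _ _ ->]]]; rewrite sum_ffunE; apply: big1 => k /andP[ik _].
  by rewrite ffunE; case: eqP => // k0; move: (leq_trans i0 ik); rewrite -k0.
move=> pa; apply/eqP => a0; case: pa => [[[b clb [m m0 bE]]|]|[m m0 mE]].
- have := congr1 (fun c : rootlat n => c ord0) bE; rewrite a0 !ffunE dE.
  suff -> : b ord0 = 0 by rewrite add0r => -[mE]; rewrite -mE in m0.
  by case: clb => [/cl0 //|[c /cl0 c0 <-]]; rewrite ffunE c0 oppr0.
- move=> [i [j [i0 ij jn aE]]].
  have ni : (i < n.+1)%N by rewrite ltnS (leq_trans ij).
  have := congr1 (fun c : rootlat n => c (Ordinal ni)) aE.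
  rewrite a0 sum_ffunE (bigD1 (Ordinal ni)) /= ?leqnn //= big1 ?addr0 ?ffunE ?eqxx //.
  by move=> l /andP[_ lk]; rewrite ffunE eq_sym (negbTE lk).
- have := congr1 (fun c : rootlat n => c ord0) mE; rewrite a0 ffunE dE => -[mE0].
  by rewrite -mE0 in m0.
Qed.

Lemma unit_1_sub_zexp (R : comUnitRingType) a :
  pos_root a -> 1 - zexp R a \is a GRing.unit.
Proof.
move=> /pos_root_neq0 a0; rewrite unfold_in /= /mfps_unit mfps_coefB mfps_coef1.
rewrite /zexp eqxx.
have -> : rootlat_of_mnm 0%MM = 0 by apply/ffunP => i; rewrite !ffunE mnm0E.
by rewrite eq_sym (negbTE a0) subr0 unitr1.
Qed.

Lemma zexpD (R : comNzRingType) (m m' : 'X_{1..n.+1}) :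
  zexp R (rootlat_of_mnm m + rootlat_of_mnm m') =
  zexp R (rootlat_of_mnm m) * zexp R (rootlat_of_mnm m').
Proof.
have addE (k k' : 'X_{1..n.+1}) :
    rootlat_of_mnm k + rootlat_of_mnm k' = rootlat_of_mnm (k + k').
  by apply/ffunP => i; rewrite !ffunE mnmDE PoszD.
apply: funext => k; rewrite addE mfps_coefM /zexp !(inj_eq rootlat_of_mnm_inj).
have [->|km] := eqVneq k (m + m')%MM.
  have dm : (mdeg m < (mdeg (m + m')%MM).+1)%N by rewrite mdegD ltnS leq_addr.
  have dm' : (mdeg m' < (mdeg (m + m')%MM).+1)%N by rewrite mdegD ltnS leq_addl.
  rewrite (bigD1 (BMultinom dm, BMultinom dm')) //= !eqxx mulr1 big1 ?addr0 //.
  move=> -[k1 k2] /= /andP[_ ne]; rewrite !(inj_eq rootlat_of_mnm_inj).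
  case: eqP => [e1|]; rewrite ?mul0r // mul1r; case: eqP => // e2.
  by case/eqP: ne; congr (_, _); apply: val_inj.
rewrite big1 // => -[k1 k2] /= /eqP kE; rewrite !(inj_eq rootlat_of_mnm_inj).
case: eqP => [e1|]; rewrite ?mul0r // mul1r; case: eqP => // e2.
by rewrite kE e1 e2 eqxx in km.
Qed.

End Roots.

(* (row, column), both counted from 1. *)
Definition site : Type := (nat * nat)%type.

Section Walls.
Variable n : nat.
Implicit Types (Y : {fset site}) (s : site) (i : 'I_n.+1).

(* The index set I is 'I_n.+1 with its structure of Z/(n+1)Z. *)
Definition color s : 'I_n.+1 := inZp s.1 - inZp s.2.

Definition is_gyw Y : Prop :=
  (forall s, s \in Y -> (0 < s.1)%N && (0 < s.2)%N) /\
  (forall j c, (0 < c)%N -> (j, c.+1) \in Y -> (j, c) \in Y).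

Definition row_len Y (k : nat) : nat := #|` [fset s in Y | s.1 == k]%fset|.

Definition color_count Y i : nat := #|` [fset s in Y | color s == i]%fset|.

Definition wt Y : rootlat n :=
  - \sum_(i < n.+1) simple_root i *+ color_count Y i.

Definition proper_gyw Y : Prop :=
  forall k l : nat, (0 < l)%N -> (l < k)%N -> k = l %[mod n.+1] ->
    (row_len Y k <= row_len Y l)%N.

Definition col_count Y i (k : nat) : nat :=
  #|` [fset s in Y | (s.2 == k) && (color s == i)]%fset|.

Definition removable_delta Y (k : nat) : Prop :=
  forall i, (col_count Y (i - inZp 1%N)%R k.+1 < col_count Y i k)%N.

Definition reduced_gyw Y : Prop := forall k : nat, (0 < k)%N -> ~ removable_delta Y k.

Definition Yinf : set {fset site} :=
  [set Y | [/\ is_gyw Y, proper_gyw Y & reduced_gyw Y]].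

Lemma color_succ j c : color (j, c.+1) = color (j, c) - inZp 1%N.
Proof.
rewrite /color /= -addrA -opprD; congr (_ - _); apply: val_inj => /=.
by rewrite modnDm addn1.
Qed.

Lemma removable_deltaP Y k : is_gyw Y ->
  removable_delta Y k <->
  exists B : {fset site},
    [/\ (B `<=` Y)%fset, forall s, s \in B -> s.2 = k,
        forall i, color_count B i = 1%N & is_gyw (Y `\` B)%fset].
Proof.
move=> [Y0 YS].
pose A i := [fset s in Y | (s.2 == k) && (color s == i)]%fset.
pose D i := [fset s in Y | (s.2 == k.+1) && (color s == (i - inZp 1%N)%R)]%fset.
pose sh (s : site) : site := (s.1, k).
have AP i s : (s \in A i) = [&& s \in Y, s.2 == k & color s == i].
  by rewrite !inE.
have DP i s : (s \in D i) = [&& s \in Y, s.2 == k.+1 & color s == (i - inZp 1%N)%R].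
  by rewrite !inE.
have shD i : #|` [fset sh s | s in D i]%fset| = #|` D i|.
  apply: card_in_imfset => -[j c] [j' c'].
  by rewrite !DP /= => /and3P[_ /eqP -> _] /and3P[_ /eqP -> _] [->].
have YSk j : (j, k.+1) \in Y -> (0 < k)%N -> (j, k) \in Y by move=> *; apply: YS.
split=> [rem|[B [BY Bk B1 [_ gB]]]].
  have /choice[b bP] i : exists s, (s \in A i) && ((s.1, k.+1) \notin Y).
    apply: contrapT => /forallNP no.
    have : (#|` A i| <= #|` D i|)%N.
      rewrite -shD; apply: fsubset_leq_card; apply/fsubsetP => -[j c] sA.
      have := no (j, c); rewrite sA /= => /negP; rewrite negbK => jY.
      move: sA; rewrite AP /= => /and3P[_ /eqP ck /eqP ci].
      apply/imfsetP; exists (j, k.+1); last by rewrite /sh /= ck.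
      by rewrite /= DP jY eqxx /= color_succ -ck ci.
    by rewrite leqNgt; move/negP; apply; exact: rem.
  have bA i : [/\ b i \in Y, (b i).2 = k, color (b i) = i & ((b i).1, k.+1) \notin Y].
    by have /andP[] := bP i; rewrite AP => /and3P[? /eqP ? /eqP ?].
  pose B : {fset site} := [fset b i | i in 'I_n.+1]%fset.
  have BP s : s \in B -> exists i, s = b i by case/imfsetP => i _ ->; exists i.
  exists B; split.
  - by apply/fsubsetP => s /BP[i ->]; have [] := bA i.
  - by move=> s /BP[i ->]; have [] := bA i.
  - move=> i; apply/eqP; rewrite /color_count; apply/cardfs1P; exists (b i).
    apply/fsetP => s; rewrite !inE; apply/andP/eqP => [[/BP[l ->] /eqP]|->].
      by have [_ _ -> _] := bA l => ->.
    have [_ _ -> _] := bA i; split=> //.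
    by apply/imfsetP; exists i.
  - split=> [s|j c c0]; first by rewrite inE => /andP[_ /Y0].
    rewrite !inE => /andP[_ jc]; rewrite YS // andbT; apply/negP => /BP[i e].
    by have [_ ] := bA i; rewrite -e /= => <- _; rewrite jc.
move=> i; rewrite /removable_delta /col_count -/(A i) -/(D i) -shD.
have /eqP/cardfs1P[s sE] := B1 i.
have : s \in [fset s in B | color s == i]%fset by rewrite sE inE.
rewrite !inE => /andP[sB /eqP si].
have sY := fsubsetP BY s sB; have sk := Bk s sB.
have k0 : (0 < k)%N by have /andP[_] := Y0 s sY; rewrite sk.
have sA : s \in A i by rewrite AP sY sk si !eqxx.
have sD : s \notin [fset sh s | s in D i]%fset.
  apply/imfsetP => -[[j c]] /=; rewrite DP /= => /and3P[jY /eqP ck _] e.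
  rewrite ck in jY.
  have jB : (j, k.+1) \notin B.
    by apply/negP => /Bk /= /eqP; rewrite gtn_eqF.
  have := gB j k k0; rewrite !inE jY jB => /(_ isT).
  by rewrite -[(j, k)]/(sh (j, c)) -e sB.
apply: fproper_ltn_card; rewrite fproperE; apply/andP; split; last first.
  by apply/negP => /fsubsetP/(_ s sA); rewrite (negbTE sD).
apply/fsubsetP.
move=> x /imfsetP[[j c]] /=; rewrite DP /= => /and3P[jY /eqP ck ci] ->.
rewrite /sh /= AP /= eqxx YSk -?ck //=.
move: ci; rewrite ck color_succ => /eqP/addIr ->; exact: eqxx.
Qed.

End Walls.

(* x = d ^ nexp d x * ncof d x with ncof d x not divisible by d, for x > 0 and
   1 < d; both are 0 at x = 0. (logn is of no use here, as d may be composite.) *)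
Definition nexp (d x : nat) : nat := \max_(e < x.+1 | (d ^ e %| x)%N) e.
Definition ncof (d x : nat) : nat := (x %/ d ^ nexp d x)%N.

Lemma nexp0 d : nexp d 0 = 0%N.
Proof. by apply: big1 => e _; rewrite (ord1 e). Qed.

Lemma ncof0 d : ncof d 0 = 0%N.
Proof. by rewrite /ncof div0n. Qed.

Lemma nexp_ncof d x : (1 < d)%N -> (0 < x)%N ->
  x = (d ^ nexp d x * ncof d x)%N /\ ~~ (d %| ncof d x)%N.
Proof.
move=> d1 x0.
have dvd : (d ^ nexp d x %| x)%N.
  rewrite /nexp; have [|e de ->] := @eq_bigmax_cond _
    [pred e : 'I_x.+1 | (d ^ e %| x)%N] (fun e : 'I_x.+1 => e : nat); last exact: de.
  by apply/card_gt0P; exists ord0; rewrite inE /= expn0 dvd1n.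
have xE : x = (d ^ nexp d x * ncof d x)%N by rewrite mulnC divnK.
split=> //; apply/negP => /dvdnP[y yE].
have dS : (d ^ (nexp d x).+1 %| x)%N.
  by rewrite [X in (_ %| X)%N]xE yE expnSr mulnCA dvdn_mull.
have lt : ((nexp d x).+1 < x.+1)%N.
  by rewrite ltnS (leq_trans (ltnW (ltn_expl _ d1))) // dvdn_leq.
have := @leq_bigmax_cond _ [pred e : 'I_x.+1 | (d ^ e %| x)%N]
  (fun e : 'I_x.+1 => e : nat) (Ordinal lt) dS.
by rewrite -/(nexp d x) /= ltnn.
Qed.

Section Statistic.
Variable n : nat.
Implicit Types (Y : {fset site}).

Definition Sset Y (j : nat) : set nat :=
  [set row_len Y (n.+1 * m + j) | m in [set: nat]].

Definition pexp Y (m : nat) : nat := nexp n.+1 (row_len Y (n.+1 * m.+1)).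
Definition qcof Y (m : nat) : nat := ncof n.+1 (row_len Y (n.+1 * m.+1)).

Definition Qset Y : set nat :=
  (\bigcup_(m in [set: nat]) [set (n.+1 ^ s * qcof Y m)%N | s in `I_(pexp Y m)])
    `|` [set 0%N].

(* The big operators over sets of naturals have finite support, and the sets
   S_j(Y) are finite (see finite_Sset and finite_pexp_supp below). *)
Definition Pstat Y : nat :=
  (\big[addn/0]_(t \in [set t | (1 <= t) && ~~ (n.+1 %| t)])
     \big[maxn/0]_(m \in [set m | qcof Y m = t]) pexp Y m)%N.

Definition Nstat Y : nat :=
  (n * Pstat Y + \sum_(1 <= j < n.+2) #|` fset_set (Sset Y j `\` Qset Y)|)%N.

Lemma row_len_large Y : exists M : nat, forall k, (M <= k)%N -> row_len Y k = 0%N.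
Proof.
exists (\max_(s <- Y) s.1).+1 => k Mk; apply/eqP; rewrite cardfs_eq0.
apply/eqP/fsetP => s; rewrite !inE; apply/negP => /andP[sY /eqP sk].
have : (s.1 <= \max_(s <- Y) s.1)%N by apply: leq_bigmax_seq.
by rewrite sk leqNgt Mk.
Qed.

Lemma finite_Sset Y j : finite_set (Sset Y j).
Proof.
have [M M0] := row_len_large Y.
apply: (@sub_finite_set _ _
  ([set row_len Y (n.+1 * m + j) | m in `I_M] `|` [set 0%N])).
  move=> _ [m _ <-]; have [mM|Mm] := ltnP m M; first by left; exists m.
  right; apply: M0; rewrite (leq_trans Mm) // (leq_trans (leq_pmull m (ltn0Sn n))) //.
  exact: leq_addr.
by rewrite finite_setU; split=> //; apply: finite_image; apply: finite_II.
Qed.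

Lemma finite_pexp_supp Y : finite_set [set m | pexp Y m != 0%N].
Proof.
have [M M0] := row_len_large Y.
apply: (@sub_finite_set _ _ `I_M); last exact: finite_II.
move=> m /=; rewrite ltnNge; apply: contraNN => Mm; rewrite /pexp M0 ?nexp0 //.
by rewrite (leq_trans Mm) // (leq_trans (leqnSn m)) // leq_pmull.
Qed.

End Statistic.

(* Main.v *)
Require Import Defs.
From mathcomp Require Import all_boot all_order all_algebra finmap.
From mathcomp Require Import boolp classical_sets functions cardinality fsbigop.
From mathcomp Require Import mpoly.
From mathcomp Require Import zify.

(* Let p = n+1 and u = 1 - q^-1.  A proper wall is the same thing as the numbers
   mu(N, j) of rows of length N >= 1 in each class j modulo p of row indices, and
   it is reduced iff for every N some mu(N, j) vanishes.  A row of length N and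
   class j weighs seg N j; these are the positive roots with multiplicity, except
   that for p | N there is one segment too many (all p of them weigh the same
   multiple of delta), and class 0 is dropped.  Since (1 - q^-1 x) / (1 - x)
   = 1 + u (x + x^2 + ...), the product enumerates Kostant partitions c(N, j) with
   weight u^(number of nonzero c(N, j)).

   The p segments of length N together weigh N delta, as does a segment of length
   pN.  Put M(N) = mu(N, 0) + mu(pN, 0) + mu(p^2 N, 0) + ...; then mu |-> c with
   c(N, j) = mu(N, j) + M(pN) for j <> 0, and c(N, 0) = M(N) when p does not
   divide N, is a weight-preserving bijection from the aperiodic mu to the Kostant
   partitions.  The inverse recovers M by M(pN) = min(M(N), min_{j <> 0} c(N, j)).
   Finally M(pN) > 0 iff N lies in Q(Y), so N(Y) counts n for such an N and the
   number of j with mu(N, j) > 0 for the others, and this is the number of nonzero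
   c(N, j) because sum_N [M(pN) > 0] = sum_{p | N} [M(N) > 0]. *)

Set Implicit Arguments.
Unset Strict Implicit.
Unset Printing Implicit Defensive.

Import GRing.Theory.
Local Open Scope classical_set_scope.
Local Open Scope ring_scope.

(** * Segments and positive roots *)

Section Segments.
Variable n : nat.
Local Open Scope nat_scope.
Implicit Types (N a b r c : nat) (i j : 'I_n.+1).

(* The rows k with inZp k = j form class j; the box of such a row in column c has
   color j - c, so seg N j i counts the i-colored boxes of a row of length N. *)
Definition seg N j i : nat := \sum_(c < N) (j - inZp c.+1 == i :> 'I_n.+1)%R.

Lemma inZpD a b : (inZp (a + b) = inZp a + inZp b :> 'I_n.+1)%R.
Proof. by apply: val_inj; rewrite /= modnDm. Qed.

Lemma inZp_ord i : inZp i = i.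
Proof. by apply: val_inj; rewrite /= modn_small. Qed.

Lemma inZp_eq0 a : (inZp a == 0 :> 'I_n.+1)%R = (n.+1 %| a).
Proof. by rewrite -val_eqE. Qed.

Lemma seg0 j i : seg 0 j i = 0.
Proof. by rewrite /seg big_ord0. Qed.

Lemma seg_cat a b j i : seg (a + b) j i = seg a j i + seg b (j - inZp a)%R i.
Proof.
rewrite /seg big_split_ord /=; congr (_ + _); apply: eq_bigr => c _ /=.
by rewrite -addnS inZpD opprD addrA.
Qed.

Lemma sum_seg N j : \sum_i seg N j i = N.
Proof.
rewrite /seg exchange_big /= -[RHS]mul1n -[N in RHS]card_ord mulnC -sum_nat_const.
apply: eq_bigr => c _; rewrite (bigD1 (j - inZp c.+1)%R) //= eqxx big1 //.
by move=> i; rewrite eq_sym => /negbTE ->.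
Qed.

Lemma sum_seg_class N i : \sum_j seg N j i = N.
Proof.
rewrite /seg exchange_big /= -[RHS]mul1n -[N in RHS]card_ord mulnC -sum_nat_const.
apply: eq_bigr => c _; rewrite (bigD1 (i + inZp c.+1)%R) //= addrK eqxx big1 //.
by move=> j ji; rewrite subr_eq (negbTE ji).
Qed.

Lemma seg_period j i : seg n.+1 j i = 1.
Proof.
rewrite /seg; pose h (c : 'I_n.+1) : 'I_n.+1 := (j - inZp c.+1)%R.
have h_inj : injective h.
  move=> c c' /addrI/oppr_inj; rewrite -(addn1 c) -(addn1 c') !inZpD => /addIr.
  by rewrite !inZp_ord.
rewrite -(reindex_inj (P := xpredT) (F := fun k => (k == i) : nat) h_inj) /=.
by rewrite (bigD1 i) //= eqxx big1 // => k /negbTE ->.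
Qed.

Lemma seg_full N j i : seg (n.+1 * N) j i = N.
Proof.
elim: N j => [|N IH] j; first by rewrite muln0 seg0.
by rewrite mulnS seg_cat seg_period IH.
Qed.

(** Both sides count the [i]-colored boxes in a row of N + 1 boxes: the left one splits off the last
    box, the right one the first, whose removal shifts all colors by one. *)
Lemma seg_shift N j i :
  seg N j i + (j - inZp N.+1 == i)%R = seg N j (i + inZp 1)%R + (j - inZp 1 == i)%R.
Proof.
have -> : seg N j i + (j - inZp N.+1 == i)%R = seg N.+1 j i.
  by rewrite /seg big_ord_recr.
rewrite -[N.+1]add1n seg_cat addnC; congr (_ + _).
  rewrite /seg; apply: eq_bigr => c _; congr nat_of_bool.
  by rewrite addrAC subr_eq.
by rewrite /seg big_ord_recl big_ord0 addn0.
Qed.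

(** By [seg_shift], the count of color i exceeds that of i + 1 by [i is the first color] -
    [i is the color of box N + 1]. As p does not divide N, these colors differ, so the first color j
    - 1 is the only one with excess 1. *)
Lemma seg_inj N j j' : ~~ (n.+1 %| N) -> seg N j =1 seg N j' -> j = j'.
Proof.
move=> pN e.
have := seg_shift N j (j - inZp 1)%R; have := seg_shift N j' (j - inZp 1)%R.
rewrite !e eqxx.
have -> : (j - inZp N.+1 == j - inZp 1)%R = false.
  rewrite (inj_eq (addrI _)) (inj_eq oppr_inj) -[N.+1]add1n inZpD -subr_eq0 addrAC subrr add0r.
  by rewrite inZp_eq0; apply/negbTE.
move=> e1 e2.
have : (j' - inZp 1 == j - inZp 1)%R by move: e1 e2; do 2 case: eqP => _ //; lia.
by move/eqP/addIr.
Qed.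

(** A row of class b + 1 starts with color b and descends; b - a + 1 boxes reach a without passing
    color 0. *)
Lemma seg_interval a b i : 0 < a -> a <= b -> b <= n ->
  seg (b - a).+1 (inZp b.+1) i = (a <= i <= b).
Proof.
move=> a0 ab bn; rewrite /seg.
have E (c : 'I_(b - a).+1) :
    (inZp b.+1 - inZp c.+1 == i :> 'I_n.+1)%R = (c == b - i :> nat) && (i <= b).
  have cb : c <= b by have := ltn_ord c; lia.
  have -> : (inZp b.+1 = inZp (b - c) + inZp c.+1 :> 'I_n.+1)%R.
    by rewrite -inZpD; congr inZp; lia.
  rewrite addrK -val_eqE /= modn_small; last by lia.
  by lia.
under eq_bigr do rewrite E.
have [ib|ib] := leqP i b; last first.
  by rewrite big1 ?andbF // => c _; rewrite andbF.
have [ai|ai] := leqP a i; last first.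
  rewrite big1 // => c _; have := ltn_ord c; lia.
have l : b - i < (b - a).+1 by lia.
rewrite (bigD1 (Ordinal l)) //= eqxx big1 //= => c.
by rewrite -val_eqE /= => /negbTE ->.
Qed.

End Segments.

(** * The weights of segments are the positive roots *)

Section RootSegments.
Variable n : nat.
Implicit Types (N a b : nat) (i j : 'I_n.+1).

Definition segm N j : 'X_{1..n.+1} := [multinom seg N j i | i < n.+1].

Definition rootv N j : rootlat n := rootlat_of_mnm (segm N j).

Lemma rootvE N j i : rootv N j i = Posz (seg N j i).
Proof. by rewrite ffunE mnmE. Qed.

Lemma mdeg_segm N j : mdeg (segm N j) = N.
Proof.
by rewrite mdegE -[RHS](sum_seg N j); apply: eq_bigr => i _; rewrite mnmE.
Qed.

Lemma rootv_height N N' j j' : rootv N j = rootv N' j' -> N = N'.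
Proof. by move/rootlat_of_mnm_inj/(congr1 mdeg); rewrite !mdeg_segm. Qed.

Lemma delta_mulnE m i : (delta_root n *+ m) i = Posz m.
Proof. by rewrite ffunMnE deltaE -natz. Qed.

Lemma cl_interval_coef a b i :
  (\sum_(k < n.+1 | (a <= k <= b)%N) simple_root k) i = Posz (a <= i <= b)%N.
Proof.
rewrite sum_ffunE; have [kij|kij] := boolP (a <= i <= b)%N.
  rewrite (bigD1 i) //= big1 ?addr0; first by rewrite ffunE eqxx.
  by move=> l /andP[_ lk]; rewrite ffunE eq_sym (negbTE lk).
apply: big1 => l lij; rewrite ffunE; case: eqP => // kl.
by rewrite kl lij in kij.
Qed.

Lemma rootv_im m j : rootv (n.+1 * m) j = delta_root n *+ m.
Proof. by apply/ffunP => i; rewrite rootvE seg_full delta_mulnE. Qed.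

Lemma rootv_interval a b : (0 < a)%N -> (a <= b)%N -> (b <= n)%N ->
  rootv (b - a).+1 (inZp b.+1) = \sum_(k < n.+1 | (a <= k <= b)%N) simple_root k.
Proof.
by move=> a0 ab bn; apply/ffunP => i; rewrite rootvE cl_interval_coef seg_interval.
Qed.

Lemma rootv_cat N N' j : rootv (N + N') j = rootv N j + rootv N' (j - inZp N).
Proof. by apply/ffunP => i; rewrite [RHS]ffunE !rootvE seg_cat PoszD. Qed.

Lemma rootv_addfull N m j : rootv (N + n.+1 * m) j = rootv N j + delta_root n *+ m.
Proof. by rewrite rootv_cat rootv_im. Qed.

(** The first r boxes of a row of length p and the other p - r together weigh delta. This handles
    the segments shorter than p that pass through color 0. *)
Lemma rootv_compl r j : (r <= n.+1)%N ->
  rootv r j = delta_root n - rootv (n.+1 - r) (j - inZp r).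
Proof.
move=> rn; have := rootv_im 1 j.
by rewrite muln1 mulr1n -[X in rootv X](subnKC rn) rootv_cat => <-; rewrite addrK.
Qed.

(** Split N = r + p m, where p m boxes weigh m delta. The other r have colors k - 1, ..., k - r: a
    positive classical root if 0 < r < k, and delta minus such a root if r >= k. *)
Lemma pos_root_rootv N j : (0 < N)%N -> pos_root (rootv N j).
Proof.
move=> N0; rewrite (divn_eq N n.+1) addnC mulnC.
set r := (N %% n.+1)%N; set m := (N %/ n.+1)%N.
have rp : (r < n.+1)%N by rewrite ltn_mod.
have Nrm : N = (m * n.+1 + r)%N := divn_eq N n.+1.
have [r0|r0] := posnP r.
  right; exists m; last by rewrite r0 add0n rootv_im.
  by move: N0; rewrite Nrm r0 addn0 muln_gt0 andbT.
left; rewrite rootv_addfull.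
(* The representative of [j] is taken in 1..p, so that the first color k - 1 lies in 0..n. *)
have [k [k0 kp kE]] : exists k, [/\ (0 < k)%N, (k <= n.+1)%N & j = inZp k].
  have [jE|j0] := posnP j.
    by exists n.+1; split=> //; apply: val_inj; rewrite /= modnn jE.
  by exists (j : nat); split=> //; [apply: ltnW | rewrite inZp_ord].
have [rk|kr] := ltnP r k.
  have cl : cl_pos_root (rootv r j).
    exists (k - r)%N, k.-1; split; [lia|lia|lia|].
    by rewrite -rootv_interval; [congr rootv; [lia|rewrite kE; congr inZp; lia]|lia..].
  have [->|m0] := posnP m; first by right; rewrite mulr0n addr0.
  by left; exists (rootv r j); [left | exists m].
left; exists (- rootv (n.+1 - r) (j - inZp r)); last first.
  by exists m.+1 => //; rewrite (rootv_compl _ (ltnW rp)) mulrS addrCA addrA.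
right; exists (rootv (n.+1 - r) (j - inZp r)) => //.
exists k, (k + n.+1 - r).-1; split; [lia|lia|lia|].
rewrite -rootv_interval; [congr rootv; [lia|]|lia..].
apply/eqP; rewrite subr_eq -inZpD kE; apply/eqP/val_inj => /=.
rewrite -[LHS]modnDr; congr modn; lia.
Qed.

Lemma pos_rootP (a : rootlat n) : pos_root a -> exists N j, (0 < N)%N /\ a = rootv N j.
Proof.
have cl (b : rootlat n) : cl_pos_root b ->
    exists N j, [/\ (0 < N)%N, (N <= n)%N & b = rootv N j].
  move=> [i [j [i0 ij jn ->]]].
  by exists (j - i).+1, (inZp j.+1); rewrite rootv_interval //; split=> //; lia.
case=> [[[b clb [m m0 ->]]|/cl[N [j [N0 _ ->]]]]|[m m0 ->]].
- case: clb => [/cl[N [j [N0 _ ->]]]|[c /cl[N [j [N0 Nn ->]] <-]]].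
    by exists (N + n.+1 * m)%N, j; rewrite rootv_addfull; split=> //; lia.
  (* Here -beta + m delta is regrouped as (delta - beta) + (m - 1) delta. *)
  exists (n.+1 - N + n.+1 * m.-1)%N, (j - inZp N); split.
    by rewrite addn_gt0 subn_gt0 ltnS Nn.
  rewrite rootv_addfull (rootv_compl j (leqW Nn)) opprB -[in LHS](prednK m0) mulrS.
  by rewrite addrA subrK.
- by exists N, j.
- by exists (n.+1 * m)%N, 0; rewrite rootv_im; split=> //; lia.
Qed.

(* Class 0 is left out at the multiples of n+1, where all n+1 segments of the
   same length have the same weight, a multiple of delta, of multiplicity n. *)
Definition Kidx N j := (0 < N)%N && ~~ ((n.+1 %| N)%N && (j == 0)).

(** For p | N all classes share one weight and dropping class 0 leaves n of them; otherwise
    [seg_inj] leaves one. A product over roots with multiplicity thus becomes a product over pairs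
    (N, j). *)
Lemma root_multE N j : (0 < N)%N ->
  root_mult (rootv N j) = #|[pred k | Kidx N k && (rootv N k == rootv N j)]|.
Proof.
move=> N0; rewrite /root_mult; have [/dvdnP[m NE]|pN] := boolP (n.+1 %| N)%N.
  rewrite {}NE mulnC rootv_im in N0 *; case: asboolP => [_|]; last first.
    by case; exists m => //; move: N0; rewrite muln_gt0 => /andP[].
  rewrite -[LHS]/(n.+1.-1) -[in LHS](card_ord n.+1) -(cardC1 (0 : 'I_n.+1)).
  by apply: eq_card => k; rewrite !inE /Kidx rootv_im eqxx andbT dvdn_mulr //= N0.
case: asboolP => [[m m0 e]|_].
  rewrite -(rootv_im m 0) in e; move/rootv_height: e pN => ->.
  by rewrite dvdn_mulr.
rewrite -(card1 j); apply: eq_card => k; rewrite !inE /Kidx N0 (negbTE pN) /=.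
apply/eqP/eqP => [->//|e]; apply: (@seg_inj n N) => // i.
by have /(congr1 (fun v : rootlat n => v i)) := e; rewrite !rootvE => -[].
Qed.

End RootSegments.

(** * From aperiodic multiplicities to Kostant partitions *)

Section ExponentCofactor.
Local Open Scope nat_scope.
Variable p : nat.
Hypothesis p_gt1 : 1 < p.

Lemma nexp_ncof_uniq e t : ~~ (p %| t) ->
  nexp p (p ^ e * t) = e /\ ncof p (p ^ e * t) = t.
Proof.
move=> pt; have t0 : 0 < t by case: t pt => //; rewrite dvdn0.
have p0 : 0 < p := ltnW p_gt1.
have x0 : 0 < p ^ e * t by rewrite muln_gt0 expn_gt0 p0.
have [xE pb] := nexp_ncof p_gt1 x0.
have eE : nexp p (p ^ e * t) = e; last first.
  by split=> //; rewrite /ncof eE mulKn // expn_gt0 p0.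
move: xE pb; set a := nexp _ _; set b := ncof _ _ => xE pb.
have [ae|ea|//] := ltngtP a e.
  move: xE; rewrite -(subnKC ae) addSnnS expnD -mulnA => /eqP.
  rewrite eqn_pmul2l ?expn_gt0 ?p0 // expnS -mulnA => /eqP bE.
  by rewrite -bE dvdn_mulr in pb.
move: xE; rewrite -(subnKC ea) addSnnS expnD -mulnA => /eqP.
rewrite eqn_pmul2l ?expn_gt0 ?p0 // expnS -mulnA => /eqP tE.
by rewrite tE dvdn_mulr in pt.
Qed.

Lemma nexp_ndvd t : ~~ (p %| t) -> nexp p t = 0 /\ ncof p t = t.
Proof. by move=> /(nexp_ncof_uniq 0); rewrite expn0 mul1n. Qed.

Lemma nexp_mul N : 0 < N ->
  nexp p (p * N) = (nexp p N).+1 /\ ncof p (p * N) = ncof p N.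
Proof.
move=> N0; have [NE pt] := nexp_ncof p_gt1 N0.
by rewrite [in p * N]NE mulnA -expnS; apply: nexp_ncof_uniq.
Qed.

(** Induction along a chain t, p t, p^2 t, ... with p not dividing t, the order in which M is
    recovered from c. *)
Lemma mul_ind (P : nat -> Prop) :
  (forall N, ~~ (p %| N) -> P N) -> (forall N, 0 < N -> P N -> P (p * N)) ->
  forall N, 0 < N -> P N.
Proof.
move=> P0 PS N N0; have [NE pt] := nexp_ncof p_gt1 N0.
have t0 : 0 < ncof p N by case: (ncof p N) pt => //; rewrite dvdn0.
rewrite NE.
elim: (nexp p N) => [|e IH]; first by rewrite expn0 mul1n; apply: P0.
by rewrite expnS -mulnA; apply: PS => //; rewrite muln_gt0 expn_gt0 (ltnW p_gt1).
Qed.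

(** Multiples of p beyond B contribute nothing. This is the identity sum_N G(pN) = sum_{p | N} G(N)
    behind both the weight and the count below. *)
Lemma sum_multiples B (G : nat -> nat) : G 0 = 0 ->
  (forall N, B < N -> G N = 0) ->
  \sum_(N < B.+1) G (p * N) = \sum_(N < B.+1 | p %| N) G N.
Proof.
move=> G0 GB.
have p0 : 0 < p := ltnW p_gt1.
have -> : \sum_(N < B.+1) G (p * N) = \sum_(N < (p * B).+1 | p %| N) G N.
  elim: B {GB} => [|B IH]; first by rewrite muln0 [RHS]big_mkcond !big_ord1 muln0 G0 if_same.
  rewrite big_ord_recr IH /= -!(big_mkord (fun N => p %| N) G).
  rewrite (big_cat_nat (n := (p * B).+1) (p := (p * B.+1).+1)) //=; last by rewrite ltnS leq_mul.
  congr (_ + _); rewrite big_mkcond big_nat_recr /=; last first.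
    by rewrite mulnS -addn1 addnC leq_add2r.
  rewrite dvdn_mulr // big1_seq ?add0n // => N; rewrite mem_index_iota => /and3P[_ lo hi].
  case: ifP => // /dvdnP[k kE]; move: lo hi.
  by rewrite kE (mulnC k) !ltn_pmul2l // ltnS ltnNge => /negbTE ->.
rewrite -!(big_mkord (fun N => p %| N) G).
rewrite (big_cat_nat (n := B.+1) (p := (p * B).+1)) //=; last by rewrite ltnS leq_pmull.
rewrite [X in _ + X]big1_seq ?addn0 // => N; rewrite mem_index_iota => /and3P[_ BN _].
exact: GB.
Qed.

End ExponentCofactor.

(** * The bijection between mu and c, with its inverse *)

Section Transfer.
Local Open Scope nat_scope.
Variables (n B : nat).
Hypothesis n_gt0 : 0 < n.
Local Notation p := n.+1.
Implicit Types (mu c : nat -> 'I_n.+1 -> nat) (N : nat) (j : 'I_n.+1).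

Let p_gt1 : 1 < p. Proof. by []. Qed.

Definition supported mu := forall N j, (N == 0) || (B < N) -> mu N j = 0.

Definition aperiodic mu := forall N, 0 < N -> exists j, mu N j = 0.

Definition kostant c := forall N, p %| N -> c N ord0 = 0.

(* As mu is supported on N <= B, this is the full series over all e. *)
Definition tail mu N := \sum_(e < B) mu (N * p ^ e) ord0.

Definition to_kostant mu N j :=
  if j == ord0 then (if p %| N then 0 else tail mu N)
  else mu N j + tail mu (p * N).

(** The slot of class 0 holds x in place of c(N, 0), so that a single minimum covers M(N) and all
    c(N, j) with j <> 0. *)
Definition min_class c N x :=
  let w j := if j == ord0 then x else c N j in w [arg min_(j < ord0) w j].

(** The value M(p^e t) for t not divisible by p, starting from M(t) = c(t, 0). *)
Fixpoint min_rec c t e :=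
  if e is e'.+1 then min_class c (p ^ e' * t) (min_rec c t e') else c t ord0.

Definition min_tail c N := min_rec c (ncof p N) (nexp p N).

(** Class 0 receives M(N) - M(pN), which is to be mu(N, 0). For N > 0 the truncated subtraction is
    exact, M(pN) being the minimum of the minuends. *)
Definition of_kostant c N j :=
  (if j == ord0 then min_tail c N else c N j) - min_tail c (p * N).

Lemma min_class_le0 c N x : min_class c N x <= x.
Proof. by rewrite /min_class; case: arg_minnP => // i _ /(_ ord0 isT); rewrite eqxx. Qed.

Lemma min_class_le c N x j : j != ord0 -> min_class c N x <= c N j.
Proof.
move=> j0; rewrite /min_class; case: arg_minnP => // i _ /(_ j isT).
by rewrite (negbTE j0).
Qed.

Lemma min_class_attained c N x :
  min_class c N x = x \/ exists2 j, j != ord0 & min_class c N x = c N j.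
Proof.
rewrite /min_class; set j := arg_min _ _ _.
by have [_|j0] := eqVneq j ord0; [left | right; exists j].
Qed.

Lemma min_tail_ndvd c N : ~~ (p %| N) -> min_tail c N = c N ord0.
Proof. by move=> /(nexp_ndvd p_gt1)[e f]; rewrite /min_tail e f. Qed.

Lemma min_tail_mul c N : 0 < N ->
  min_tail c (p * N) = min_class c N (min_tail c N).
Proof.
move=> N0; have [e f] := nexp_mul p_gt1 N0; rewrite /min_tail e f /=.
by have [<- _] := nexp_ncof p_gt1 N0.
Qed.

Lemma min_tail0 c : min_tail c 0 = c 0 ord0.
Proof. by rewrite /min_tail nexp0 ncof0. Qed.

Lemma tail_large mu N : supported mu -> B < N -> tail mu N = 0.
Proof.
move=> mus BN; apply: big1 => e _; apply: mus.
by rewrite (leq_trans BN) ?orbT // leq_pmulr // expn_gt0.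
Qed.

Lemma tail0 mu : supported mu -> tail mu 0 = 0.
Proof. by move=> mus; apply: big1 => e _; apply: mus; rewrite mul0n. Qed.

Lemma tail_rec mu N : supported mu -> tail mu N = mu N ord0 + tail mu (p * N).
Proof.
move=> mus; have [->|N0] := posnP N.
  by rewrite muln0 tail0 // mus.
(* The added term e = B vanishes: p^B > B puts its length beyond B. *)
have -> : tail mu N = \sum_(e < B.+1) mu (N * p ^ e) ord0.
  rewrite big_ord_recr /= [mu (N * p ^ B) ord0]mus ?addn0 //.
  by rewrite (leq_trans (ltn_expl B p_gt1)) ?orbT // leq_pmull.
rewrite big_ord_recl expn0 muln1; congr (_ + _); apply: eq_bigr => e _.
by rewrite /= /bump add1n expnS mulnCA mulnA.
Qed.

Section ToKostant.
Variable mu : nat -> 'I_n.+1 -> nat.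
Hypothesis mu_supp : supported mu.

Lemma to_kostant_kostant : kostant (to_kostant mu).
Proof. by move=> N pN; rewrite /to_kostant eqxx pN. Qed.

Lemma to_kostant_supported : supported (to_kostant mu).
Proof.
move=> N j /orP[/eqP ->|BN]; rewrite /to_kostant.
  by rewrite muln0 tail0 // mu_supp // dvdn0 if_same.
have BpN : B < p * N by rewrite (leq_trans BN) // leq_pmull.
by rewrite !tail_large // mu_supp ?BN ?orbT // !if_same.
Qed.

(** Add sum_N M(pN) seg N 0 to both sides. On the left it completes M(pN) copies of the classes j <>
    0 to M(pN) copies of all p segments of length N, which weigh as much as M(pN) segments of length
    pN. On the right it turns mu(N, 0) into M(N). With G(N) = M(N) seg N 0, [sum_multiples] then
    matches the sides. *)
Lemma to_kostant_weight (i : 'I_n.+1) :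
  \sum_(N < B.+1) \sum_j to_kostant mu N j * seg N j i =
  \sum_(N < B.+1) \sum_j mu N j * seg N j i.
Proof.
apply/eqP; rewrite -(eqn_add2r (\sum_(N < B.+1) tail mu (p * N) * seg N ord0 i)).
rewrite -!big_split /=.
pose A N := \sum_(j | j != ord0) mu N j * seg N j i.
pose G N := tail mu N * seg N ord0 i.
have G0 : G 0 = 0 by rewrite /G tail0.
have GB N : B < N -> G N = 0 by move=> BN; rewrite /G tail_large.
transitivity (\sum_(N < B.+1) (A N + (G (p * N) + (if p %| N then 0 else G N))) ==
              \sum_(N < B.+1) (A N + G N)).
  congr (_ == _); apply: eq_bigr => N _; rewrite (bigD1 ord0) //=.
    have -> : to_kostant mu N ord0 * seg N ord0 i = if p %| N then 0 else G N.
      by rewrite /to_kostant eqxx; case: ifP; rewrite ?mul0n.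
    rewrite -[LHS]addnA [LHS]addnC [RHS]addnA; congr (_ + _).
    rewrite (eq_bigr (fun j => mu N j * seg N j i + tail mu (p * N) * seg N j i)); last first.
      by move=> j /negbTE j0; rewrite /to_kostant j0 mulnDl.
    rewrite big_split /= -addnA -/(A N); congr (_ + _).
    have -> : G (p * N) = tail mu (p * N) * \sum_j seg N j i.
      by rewrite sum_seg_class /G seg_full.
    by rewrite [in RHS](bigD1 ord0) //= mulnDr addnC [X in _ = _ + X]big_distrr.
  by rewrite /G (tail_rec N mu_supp) mulnDl -!addnA addnCA.
rewrite !big_split /= eqn_add2l (sum_multiples p_gt1 G0 GB).
rewrite [in X in _ == X](bigID (fun N : 'I_B.+1 => p %| N)) /= eqn_add2l.
by rewrite [in X in _ == X]big_mkcond /=; apply/eqP/eq_bigr => N _; case: (p %| N).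
Qed.

(** The same bookkeeping with indicators: if M(pN) > 0, all n entries with j <> 0 are nonzero;
    otherwise c(N, j) = mu(N, j) for these j, and M(N) = mu(N, 0). Adding [M(pN) > 0] to both sides
    reduces the claim to [sum_multiples]. *)
Lemma to_kostant_count :
  \sum_(N < B.+1) \sum_j (0 < to_kostant mu N j) =
  \sum_(N < B.+1) if 0 < tail mu (p * N) then n else \sum_j (0 < mu N j : nat).
Proof.
pose G N : nat := 0 < tail mu N.
pose A N := if 0 < tail mu (p * N) then n else \sum_(j | j != ord0) (0 < mu N j : nat).
have G0 : G 0 = 0 by rewrite /G tail0.
have GB N : B < N -> G N = 0 by move=> BN; rewrite /G tail_large.
apply/eqP; rewrite -(eqn_add2r (\sum_(N < B.+1) G (p * N))).
rewrite -!big_split /=.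
transitivity (\sum_(N < B.+1) (A N + (G (p * N) + (if p %| N then 0 else G N))) ==
              \sum_(N < B.+1) (A N + G N)).
  congr (_ == _); apply: eq_bigr => N _; rewrite (bigD1 ord0) //=.
    rewrite addnAC addnC; congr (_ + _); last first.
      by rewrite addnC; congr (_ + _); rewrite /to_kostant eqxx; case: (p %| N).
    rewrite /A; case: ifP => tN.
      rewrite (eq_bigr (fun=> 1)) => [|j /negbTE j0]; last first.
        by rewrite /to_kostant j0 addn_gt0 tN orbT.
      by rewrite sum1_card cardC1 card_ord.
    apply: eq_bigr => j /negbTE j0; rewrite /to_kostant j0.
    by move: tN; case: (tail _ _) => // _; rewrite addn0.
  rewrite /A /G [in RHS](tail_rec N mu_supp) addn_gt0.
  by case: ifP => tN; rewrite ?orbT // orbF addn0 addnC.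
rewrite !big_split /= eqn_add2l (sum_multiples p_gt1 G0 GB).
rewrite [in X in _ == X](bigID (fun N : 'I_B.+1 => p %| N)) /= eqn_add2l.
by rewrite [in X in _ == X]big_mkcond /=; apply/eqP/eq_bigr => N _; case: (p %| N).
Qed.

Hypothesis mu_aper : aperiodic mu.

(** Every entry of the minimum is M(pN) plus some mu(N, j), and aperiodicity makes one of these
    mu(N, j) vanish. *)
Lemma min_tail_to_kostant N : min_tail (to_kostant mu) N = tail mu N.
Proof.
have [->|] := posnP N.
  by rewrite min_tail0 tail0 // to_kostant_supported.
apply: (mul_ind p_gt1 (P := fun N => min_tail (to_kostant mu) N = tail mu N)) => {}N.
  by move=> pN; rewrite min_tail_ndvd // /to_kostant eqxx (negbTE pN).
move=> N0 IH; rewrite min_tail_mul // IH; apply/eqP; rewrite eqn_leq; apply/andP; split.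
  have [j jE] := mu_aper N0; have [j0|j0] := eqVneq j ord0.
    have := min_class_le0 (to_kostant mu) N (tail mu N).
    by rewrite [in X in _ <= X]tail_rec // -j0 jE.
  by have := min_class_le (to_kostant mu) N (tail mu N) j0; rewrite /to_kostant (negbTE j0) jE.
have [->|[j j0 ->]] := min_class_attained (to_kostant mu) N (tail mu N).
  by rewrite [X in _ <= X]tail_rec // leq_addl.
by rewrite /to_kostant (negbTE j0) leq_addl.
Qed.

Lemma to_kostantK N j : of_kostant (to_kostant mu) N j = mu N j.
Proof.
rewrite /of_kostant !min_tail_to_kostant /to_kostant; case: eqP => [->|_]; last by rewrite addnK.
by rewrite tail_rec // addnK.
Qed.

End ToKostant.

Section OfKostant.
Variable d : nat.
Hypothesis dB : p * d <= B.
Variable c : nat -> 'I_n.+1 -> nat.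
Hypothesis c_supp : forall N j, (N == 0) || (d < N) -> c N j = 0.

Lemma min_tail_mul_le N : min_tail c (p * N) <= min_tail c N.
Proof.
have [->|N0] := posnP N; first by rewrite muln0.
by rewrite min_tail_mul // min_class_le0.
Qed.

Lemma min_tail_mul_le_class N j : j != ord0 -> min_tail c (p * N) <= c N j.
Proof.
move=> j0; have [->|N0] := posnP N; first by rewrite muln0 min_tail0 c_supp.
by rewrite min_tail_mul // min_class_le.
Qed.

(** M(pk) is at most c(k, j) for any j <> 0, which exists as n > 0, and k > d once p k > B >= p d. A
    partition c with lengths up to d can thus come from rows of length up to p d, but no longer. *)
Lemma min_tail_large N : (N == 0) || (B < N) -> min_tail c N = 0.
Proof.
case/orP=> [/eqP->|BN]; first by rewrite min_tail0 c_supp.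
have [/dvdnP[k NE]|pN] := boolP (p %| N); last first.
  rewrite min_tail_ndvd // c_supp // (leq_trans _ BN) ?orbT // ltnS.
  by rewrite (leq_trans _ dB) // leq_pmull.
have j0 : (ord_max : 'I_n.+1) != ord0 by rewrite -val_eqE /= -lt0n.
move: BN; rewrite NE mulnC => BN; apply/eqP; rewrite -leqn0.
rewrite (leq_trans (min_tail_mul_le_class _ j0)) // c_supp //.
by rewrite -(ltn_pmul2l (ltn0Sn n)) (leq_ltn_trans dB BN) orbT.
Qed.

Lemma of_kostant_supported : supported (of_kostant c).
Proof.
move=> N j NB; rewrite /of_kostant min_tail_large // c_supp ?if_same //.
case/orP: NB => [->//|BN]; rewrite (leq_trans _ BN) ?orbT // ltnS.
by rewrite (leq_trans _ dB) // leq_pmull.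
Qed.

(** Subtracting M(pN) empties the class that attains the minimum defining it. *)
Lemma of_kostant_aperiodic : aperiodic (of_kostant c).
Proof.
move=> N N0; rewrite /of_kostant min_tail_mul //.
have [e|[j j0 e]] := min_class_attained c N (min_tail c N).
  by exists ord0; rewrite eqxx e subnn.
by exists j; rewrite (negbTE j0) e subnn.
Qed.

(** The differences M(N p^e) - M(N p^(e+1)) in class 0 telescope, and the last term has length
    beyond B. *)
Lemma tail_of_kostant N : tail (of_kostant c) N = min_tail c N.
Proof.
have [->|N0] := posnP N.
  by rewrite tail0 ?min_tail_large //; apply: of_kostant_supported.
have tele k : \sum_(e < k) of_kostant c (N * p ^ e) ord0 + min_tail c (N * p ^ k) = min_tail c N.
  elim: k => [|k IH]; first by rewrite big_ord0 expn0 muln1.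
  rewrite big_ord_recr /= -[RHS]IH -addnA; congr (_ + _).
  rewrite /of_kostant eqxx expnS [N * (p * _)]mulnCA subnK //; exact: min_tail_mul_le.
rewrite -[RHS](tele B) min_tail_large ?addn0 //.
by rewrite (leq_trans (ltn_expl B p_gt1)) ?orbT // leq_pmull.
Qed.

Lemma of_kostantK : kostant c -> forall N j, to_kostant (of_kostant c) N j = c N j.
Proof.
move=> ck N j; rewrite /to_kostant !tail_of_kostant; case: (eqVneq j ord0) => [->|j0].
  by case: ifP => pN; [rewrite ck | rewrite min_tail_ndvd // pN].
by rewrite /of_kostant (negbTE j0) subnK // min_tail_mul_le_class.
Qed.

End OfKostant.
End Transfer.

(** * Walls from multiplicities *)

Section FiniteSets.
Local Open Scope nat_scope.

Lemma card_fset_sep (T : choiceType) (Y : {fset T}) (P : pred T) :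
  #|` [fset s in Y | P s]%fset| = \sum_(s <- Y) P s.
Proof.
by rewrite card_fset_sum1 big_fset /= -big_mkcondr; apply: eq_bigr => s _; case: (P s).
Qed.

(** In a proper wall, both the filled columns of a row and the rows of one class reaching a given
    column form such sets. *)
Lemma mem_downclosed (X : {fset nat}) :
  (forall i i', i <= i' -> i' \in X -> i \in X) ->
  forall i, (i \in X) = (i < #|` X|).
Proof.
move=> Xd; have ex : exists k, k \notin X.
  exists (\max_(x <- X) x).+1; apply/negP => iX.
  have : (\max_(x <- X) x).+1 <= \max_(x <- X) x by apply: leq_bigmax_seq.
  by rewrite ltnn.
case: (ex_minnP ex) => k kX kmin.
have Xk i : (i \in X) = (i < k).
  apply/idP/idP => [iX|]; last by apply: contraTT; rewrite -leqNgt => /kmin.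
  by rewrite ltnNge; apply: contra kX => /Xd; apply.
move=> i; rewrite Xk; congr (_ < _).
have -> : X = [fset x in iota 0 k]%fset.
  by apply/fsetP => x; rewrite !inE Xk mem_iota.
by rewrite card_fseq undup_id ?iota_uniq // size_iota.
Qed.
End FiniteSets.

(** * Rows of a wall sorted by residue class *)

Section Rows.
Local Open Scope nat_scope.
Variable n : nat.
Local Notation p := n.+1.
Implicit Types (Y : {fset site}) (k c N : nat) (i j : 'I_n.+1).

(* Row k is the (rowidx k)-th row, counted from 0, of its class inZp k. *)
Definition rowidx k := k.-1 %/ p.

(** Rows are counted from 1, so class 0 starts at row p and not at row 0. *)
Definition rowof j r := p * r + (if j == ord0 then p else j).

Lemma rowof_gt0 j r : 0 < rowof j r.
Proof.
rewrite /rowof; have [_|j0] := eqVneq j ord0; rewrite addn_gt0 ?orbT //.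
by apply/orP; right; rewrite lt0n.
Qed.

Lemma rowof_class j r : inZp (rowof j r) = j.
Proof.
apply: val_inj; rewrite /= /rowof mulnC modnMDl.
by have [->|j0] := eqVneq j ord0; rewrite ?modnn // modn_small.
Qed.

Lemma rowof_idx j r : rowidx (rowof j r) = r.
Proof.
rewrite /rowidx /rowof; have [_|j0] := eqVneq j ord0.
  by rewrite addnS /= mulnC divnMDl // divn_small // addn0.
have : 0 < j by rewrite lt0n.
have := ltn_ord j; case: (nat_of_ord j) => // j' jn _.
by rewrite addnS /= mulnC divnMDl // divn_small ?addn0 // ltnW.
Qed.

Lemma rowidxK k : 0 < k -> rowof (inZp k) (rowidx k) = k.
Proof.
case: k => // k _; rewrite /rowof /rowidx -val_eqE /=.
rewrite [in RHS](divn_eq k p) mulnC -addnS; congr (_ + _).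
have := ltn_pmod k (ltn0Sn n); rewrite -[in k.+1 %% p]addn1 -modnDml addn1.
move: (k %% p) => r rn; have [->|rp] := eqVneq r n; first by rewrite modnn.
by rewrite modn_small //= ltnS ltn_neqAle rp.
Qed.

Lemma rowof_le j r r' : (rowof j r <= rowof j r') = (r <= r').
Proof. by rewrite /rowof leq_add2r leq_pmul2l. Qed.

Lemma color_eq k c i : (color n (k, c) == i) = (inZp k == (i + inZp c)%R).
Proof. by rewrite /color subr_eq. Qed.

(** A row of class j shows color j - c in column c, so in a wall this counts the rows of class j
    with at least c boxes, for c > 0. *)
Definition class_count Y c j := col_count Y (j - inZp c)%R c.

Lemma class_countE Y c j (X : {fset nat}) : is_gyw Y ->
  (forall r, (r \in X) = ((rowof j r, c) \in Y)) -> class_count Y c j = #|` X|.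
Proof.
move=> [Ypos _] XE; rewrite /class_count /col_count.
pose h r : site := (rowof j r, c).
have <- : #|` [fset h r | r in X]%fset| = #|` X|.
  by apply: card_in_imfset => r r' _ _ [] /(congr1 rowidx); rewrite !rowof_idx.
congr #|` _|; apply/fsetP => -[k c']; apply/idP/idP; rewrite !inE /=.
  move=> /and3P[kY /eqP cE]; rewrite color_eq cE subrK => /eqP kj.
  have [/= k0 _] := andP (Ypos _ kY); rewrite cE in kY *.
  have kE : rowof j (rowidx k) = k by rewrite -kj rowidxK.
  by apply/imfsetP; exists (rowidx k); rewrite /h /= ?XE kE.
move=> /imfsetP[r /= rX]; rewrite /h => -[-> ->].
by rewrite -XE rX eqxx color_eq subrK rowof_class eqxx.
Qed.

Definition class_rows Y c j : {fset nat} :=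
  [fset rowidx s.1 | s in [fset s in Y | (s.2 == c) && (inZp s.1 == j)]]%fset.

Lemma class_rowsE Y c j r : is_gyw Y ->
  (r \in class_rows Y c j) = ((rowof j r, c) \in Y).
Proof.
move=> [Ypos _]; apply/imfsetP/idP => [[[k c'] /=]|rY]; last first.
  by exists (rowof j r, c); rewrite /= ?rowof_idx // !inE rY rowof_class !eqxx.
rewrite !inE /= => /and3P[kY /eqP cE /eqP <-] ->; rewrite rowidxK -?cE //.
by have [] := andP (Ypos _ kY).
Qed.

Lemma card_class_rows Y c j : is_gyw Y -> #|` class_rows Y c j| = class_count Y c j.
Proof. by move=> gY; apply/esym/class_countE => // r; rewrite class_rowsE. Qed.

Lemma mem_row Y k c : is_gyw Y -> 0 < k ->
  ((k, c) \in Y) = (0 < c) && (c <= row_len Y k).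
Proof.
move=> [Ypos Ygap] k0.
have [->|c0] := posnP c; first by apply/negP => /Ypos; rewrite andbF.
pose X := [fset s.2.-1 | s in [fset s in Y | s.1 == k]]%fset.
have XE x : (x \in X) = ((k, x.+1) \in Y).
  apply/imfsetP/idP => [[[k' c'] /=]|kY]; last by exists (k, x.+1); rewrite //= !inE kY /=.
  rewrite !inE /= => /andP[kY /eqP kE] ->; rewrite -kE prednK //.
  by have [] := andP (Ypos _ kY).
have -> : row_len Y k = #|` X|.
  apply/esym/card_in_imfset => -[k1 c1] [k2 c2].
  rewrite !inE /= => /andP[Y1 /eqP ->] /andP[Y2 /eqP ->].
  have [_ /= c1_gt0] := andP (Ypos _ Y1); have [_ /= c2_gt0] := andP (Ypos _ Y2).
  by move=> e; rewrite -(prednK c1_gt0) e prednK.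
rewrite -[in LHS](prednK c0) -XE mem_downclosed ?(prednK c0) // => x x' xx'.
rewrite !XE -(subnK xx'); elim: (x' - x) => // e IH.
by rewrite addSn => /Ygap-/(_ isT)/IH.
Qed.

End Rows.

(** * The wall with given row multiplicities *)

Section WallOf.
Local Open Scope nat_scope.
Variables (n B : nat).
Local Notation p := n.+1.
Implicit Types (Y : {fset site}) (mu : nat -> 'I_n.+1 -> nat) (k c N : nat).
Implicit Types (i j : 'I_n.+1).

(* Number of rows of class j with at least c boxes. *)
Definition col_height mu c j := \sum_(c <= N < B.+1) mu N j.

(** Each class lists its rows by decreasing length: the row of index r reaches column c when r is
    less than the number of rows of length at least c. The list of sites only makes the set finite;
    h rows of one class end by row p h. *)
Definition wall mu : {fset site} :=
  [fset s in [seq (k, c) | k <- iota 1 (p * \sum_j col_height mu 1 j), c <- iota 1 B]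
     | rowidx n s.1 < col_height mu s.2 (inZp s.1)]%fset.

Lemma col_height_rec mu N j : supported B mu ->
  col_height mu N j = mu N j + col_height mu N.+1 j.
Proof.
move=> mus; rewrite /col_height; have [NB|BN] := leqP N B; first by rewrite big_ltn.
by rewrite !big_geq ?mus ?BN ?orbT // ltnW.
Qed.

Lemma col_height_le mu c c' j : c <= c' -> col_height mu c' j <= col_height mu c j.
Proof.
move=> cc'; rewrite /col_height; have [cB|Bc] := leqP c' B.+1; last first.
  by rewrite [X in X <= _]big_geq // ltnW.
by rewrite [X in _ <= X](big_cat_nat (n := c')) //= leq_addl.
Qed.

Lemma in_wall mu k c : ((k, c) \in wall mu) =
  [&& 0 < k, 0 < c & rowidx n k < col_height mu c (inZp k)].
Proof.
rewrite !inE /=; apply/andP/and3P => [[/allpairsPdep[k' [c' []]]]|[k0 c0 lt]].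
  by rewrite !mem_iota => /andP[k0 _] /andP[c0 _] [-> ->].
split=> //; apply/allpairsPdep; exists k, c; rewrite !mem_iota !add1n !ltnS k0 c0.
split=> //=; last first.
  by rewrite leqNgt; apply: contraTN lt => Bc; rewrite /col_height big_geq.
rewrite -(prednK k0) mulnC -ltn_divLR // (leq_trans lt) //.
by rewrite (leq_trans (col_height_le _ _ c0)) // (bigD1 (inZp k)) //= leq_addr.
Qed.

Lemma wall_gyw mu : is_gyw (wall mu).
Proof.
split=> [[k c]|k c c0]; rewrite !in_wall; first by case/and3P=> /= -> ->.
move=> /and3P[-> _ lt]; rewrite c0 (leq_trans lt) //; exact: col_height_le.
Qed.

Lemma class_count_wall mu c j : 0 < c ->
  class_count (wall mu) c j = col_height mu c j.
Proof.
move=> c0; rewrite (class_countE (X := [fset r in iota 0 (col_height mu c j)]%fset) (wall_gyw mu)).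
  by rewrite card_fseq undup_id ?iota_uniq // size_iota.
by move=> r; rewrite in_wall rowof_gt0 c0 rowof_class rowof_idx in_fset mem_iota.
Qed.

(** Rows of length at least N minus those of length at least N + 1. The value 0 at N = 0 discards
    the infinitely many empty rows. *)
Definition row_mult Y N j :=
  if N is 0 then 0 else class_count Y N j - class_count Y N.+1 j.

Lemma row_multK mu N j : supported B mu -> row_mult (wall mu) N j = mu N j.
Proof.
move=> mus; case: N => [|N]; first by rewrite mus.
by rewrite /row_mult !class_count_wall // (col_height_rec _ _ mus) addnK.
Qed.

Lemma wall_Yinf mu : supported B mu -> aperiodic mu -> Yinf n (wall mu).
Proof.
move=> mus mua; have gw := wall_gyw mu; split=> //.
  move=> k l l0 lk kl; have k0 := ltn_trans l0 lk.
  case rE : (row_len (wall mu) k) => [//|c].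
  have : (k, c.+1) \in wall mu by rewrite (mem_row _ gw k0) /= rE.
  have cl : inZp k = inZp l :> 'I_n.+1 by apply: val_inj.
  rewrite in_wall => /and3P[_ _ lt].
  suff : (l, c.+1) \in wall mu by rewrite (mem_row _ gw l0).
  rewrite in_wall l0 -cl (leq_ltn_trans _ lt) // leq_div2r //.
  by rewrite -ltnS !prednK // ltnW.
(* A class j with mu(k, j) = 0 has equally many rows reaching columns k and k + 1, which contradicts
   the strict drop required at color j - k. *)
move=> k k0 rem; have [j jE] := mua k k0.
have := rem (j - inZp k)%R.
rewrite -addrA -opprD -inZpD addn1 -/(class_count _ _ j) -/(class_count _ _ j).
by rewrite !class_count_wall // (col_height_rec k j mus) jE ltnn.
Qed.

Lemma class_count_le Y c j : is_gyw Y -> 0 < c ->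
  class_count Y c.+1 j <= class_count Y c j.
Proof.
move=> gY c0.
rewrite -!card_class_rows //.
apply: fsubset_leq_card; apply/fsubsetP => r; rewrite !class_rowsE //.
exact: gY.2.
Qed.

Lemma row_mult_supported Y : (forall s, s \in Y -> s.2 <= B) -> supported B (row_mult Y).
Proof.
move=> YB [|N] j //= BN; rewrite [class_count Y N.+1 j](_ : _ = 0) //.
apply/eqP; rewrite cardfs_eq0; apply/eqP/fsetP => s; rewrite !inE.
apply/negP => /and3P[/YB sB /eqP sN _]; by rewrite leqNgt sN BN in sB.
Qed.

Lemma col_height_row_mult Y c j : is_gyw Y -> (forall s, s \in Y -> s.2 <= B) ->
  0 < c -> col_height (row_mult Y) c j = class_count Y c j.
Proof.
move=> gY YB.
have large N : B < N -> class_count Y N j = 0.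
  move=> BN; apply/eqP; rewrite cardfs_eq0; apply/eqP/fsetP => s; rewrite !inE.
  apply/negP => /and3P[/YB sB /eqP sN _]; by rewrite leqNgt sN BN in sB.
have [cB|Bc] := leqP c B.+1; last by rewrite /col_height big_geq ?large // ltnW.
rewrite -(subKn cB); elim: (B.+1 - c) => [|e IH] c0.
  by rewrite subn0 /col_height big_geq ?large.
rewrite (col_height_rec _ _ (row_mult_supported YB)).
have [eB|Be] := leqP e B; last first.
  by move: c0; rewrite subSS (eqP (_ : B - e == 0)) // subn_eq0 ltnW.
rewrite subSS -subSn // IH ?subn_gt0 //.
move: c0; rewrite subSS subSn //; case: (B - e) => // N _.
by rewrite /row_mult subnK // class_count_le.
Qed.

(** Color i in column N and color i - 1 in column N + 1 belong to the same class i + N. If every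
    class had a row of length exactly N, all these counts would drop strictly and a delta would be
    removable. *)
Lemma row_mult_aperiodic Y : reduced_gyw n Y -> aperiodic (row_mult Y).
Proof.
move=> rY N N0; apply: contrapT => /forallNP no; apply: (rY N N0) => i.
have := no (i + inZp N)%R; case: N N0 no => // N _ no /eqP.
rewrite /row_mult subn_eq0 -ltnNge /class_count addrK.
by rewrite -[N.+2]addn1 inZpD opprD addrA addrK.
Qed.

(** Properness makes the rows of a class that reach column c an initial run of that class, so their
    number determines them. *)
Lemma row_multY Y : Yinf n Y -> (forall s, s \in Y -> s.2 <= B) ->
  wall (row_mult Y) = Y.
Proof.
move=> [gY pY rY] YB; apply/fsetP => -[k c]; rewrite in_wall.
have [k0|k0] := posnP k; first by rewrite k0; apply/esym/negP => /(gY.1 _).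
have [c0|c0] := posnP c; first by rewrite c0; apply/esym/negP => /(gY.1 _); rewrite andbF.
rewrite /= col_height_row_mult // -card_class_rows //.
rewrite -mem_downclosed ?class_rowsE ?rowidxK // => r r' rr'.
rewrite !class_rowsE // !mem_row ?rowof_gt0 // => /andP[-> /leq_trans->] //.
have [->//|rr] := eqVneq r r'.
apply: pY; rewrite ?rowof_gt0 //; last first.
  by have /(congr1 (@nat_of_ord _)) := etrans (rowof_class (inZp k : 'I_n.+1) r')
    (esym (rowof_class (inZp k : 'I_n.+1) r)).
by rewrite ltnNge rowof_le -ltnNge ltn_neqAle rr.
Qed.

Lemma color_count_wall mu i : supported B mu ->
  color_count (wall mu) i = \sum_(N < B.+1) \sum_j mu N j * seg N j i.
Proof.
move=> mus; pose W := wall mu.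
transitivity (\sum_(c < B) col_count W i c.+1).
  rewrite /color_count /col_count card_fset_sep.
  under [RHS]eq_bigr do rewrite card_fset_sep.
  rewrite exchange_big /= big_seq [RHS]big_seq; apply: eq_bigr => -[k c].
  rewrite in_wall => /and3P[_ c0 kc] /=.
  have cB : c <= B by rewrite leqNgt; apply: contraTN kc => Bc; rewrite /col_height big_geq.
  have lt : c.-1 < B by rewrite prednK.
  rewrite (bigD1 (Ordinal lt)) //= prednK // eqxx big1 ?addn0 // => e.
  by rewrite -val_eqE /= => ne; case: eqP => // ce; rewrite ce eqxx in ne.
(* A row of length N has a box in column c + 1 exactly when c < N. *)
transitivity (\sum_(c < B) \sum_(N < B.+1) \sum_j (c < N) * (mu N j * (j - inZp c.+1 == i)%R)).
  apply: eq_bigr => c _; rewrite exchange_big /= (bigD1 (i + inZp c.+1)%R) //=.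
  rewrite [X in _ + X]big1 ?addn0 => [|j ji]; last first.
    by apply: big1 => N _; rewrite subr_eq (negbTE ji) !muln0.
  rewrite addrK eqxx.
  transitivity (class_count W c.+1 (i + inZp c.+1)%R); first by rewrite /class_count addrK.
  rewrite class_count_wall // /col_height.
  pose F N := (c < N) * (mu N (i + inZp c.+1)%R * true).
  rewrite -[RHS](big_mkord xpredT F) [RHS](big_cat_nat (n := c.+1)) /=; last 2 first.
  - by [].
  - by rewrite ltnS ltnW.
  rewrite [X in _ = X + _]big1_seq ?add0n => [|N]; last first.
    by rewrite mem_index_iota => /and3P[_ _]; rewrite ltnS leqNgt /F => /negbTE ->.
  by apply: eq_big_nat => N /andP[cN _]; rewrite /F cN mul1n muln1.
rewrite exchange_big; apply: eq_bigr => N _ /=; rewrite exchange_big; apply: eq_bigr => j _ /=.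
have NB : N <= B by rewrite -ltnS.
transitivity (\sum_(c < B) mu N j * (if c < N then (j - inZp c.+1 == i)%R : nat else 0)).
  by apply: eq_bigr => c _; case: (c < N); rewrite ?mul1n // mul0n muln0.
rewrite -big_distrr; congr (_ * _).
by rewrite -big_mkcond -(big_ord_widen B (fun c => (j - inZp c.+1 == i)%R : nat) NB).
Qed.

End WallOf.

(** * The statistic of a wall *)

Lemma card_fset_iota (b : nat) (P : pred nat) :
  #|` [fset N in [seq N <- iota 0 b | P N]]%fset| = (\sum_(N < b) P N)%N.
Proof.
rewrite card_fseq undup_id ?filter_uniq ?iota_uniq // size_filter -sum1_count.
rewrite -(big_mkord xpredT (fun N => P N : nat)) /index_iota subn0 big_mkcond.
by apply: eq_bigr => N _; case: (P N).
Qed.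

Lemma in_fset_iota (b : nat) (P : pred nat) N :
  (N \in [fset N in [seq N <- iota 0 b | P N]]%fset) = P N && (N < b)%N.
Proof. by rewrite in_fset mem_filter mem_iota add0n. Qed.

Lemma ltn_fsbig_max (A : set nat) (F : nat -> nat) (s : nat) :
  finite_set [set m | F m != 0%N] ->
  (s < \big[maxn/0]_(m \in A) F m)%N <-> exists2 m, A m & (s < F m)%N.
Proof.
move=> Ff; have fin : finite_set (A `&` F @^-1` [set~ 0%N]).
  by apply: sub_finite_set Ff => m [_ /= /eqP].
split=> [|[m Am sF]].
  rewrite ltnNge => /negP lt; apply: contrapT => no; apply: lt.
  apply/bigmax_leqP_seq => m; rewrite in_finite_support // inE => -[Am _] _.
  by rewrite leqNgt; apply/negP => sF; apply: no; exists m.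
rewrite (leq_trans sF) //; apply: (@leq_bigmax_seq _ _ xpredT F) => //.
rewrite in_finite_support // inE; split=> // /= F0.
by rewrite F0 in sF.
Qed.

Section WallStatistic.
Local Open Scope nat_scope.
Variables (n B : nat).
Hypothesis n_gt0 : 0 < n.
Local Notation p := n.+1.
Implicit Types (k N t s : nat) (j : 'I_n.+1).
Variable mu : nat -> 'I_n.+1 -> nat.
Hypothesis mu_supp : supported B mu.
Let p_gt1 : 1 < p. Proof. by []. Qed.
Local Notation Y := (wall B mu).

Lemma row_len_wallP N j : 0 < N ->
  0 < mu N j <-> exists r, row_len Y (rowof j r) = N.
Proof.
move=> N0; have gY := wall_gyw B mu.
have rowE r c : 0 < c -> (c <= row_len Y (rowof j r)) = (r < col_height B mu c j).
  move=> c0; have := mem_row c gY (rowof_gt0 j r).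
  by rewrite c0 in_wall rowof_gt0 rowof_class rowof_idx c0.
split=> [mu0|[r rN]].
  (* This is the first row of its class with at most N boxes; mu(N, j) > 0 gives it exactly N. *)
  exists (col_height B mu N.+1 j); apply/eqP; rewrite eqn_leq rowE // leqNgt rowE // ltnn.
  by rewrite (col_height_rec N j mu_supp) -[X in X < _]add0n ltn_add2r.
have := rowE r N N0; have := rowE r N.+1 isT; rewrite rN leqnn ltnn.
rewrite (col_height_rec N j mu_supp) => /esym/negbT; rewrite -leqNgt => le /esym lt.
by move: (leq_ltn_trans le lt); rewrite -[X in X < _]add0n ltn_add2r.
Qed.

Lemma Sset_wall N k : 0 < N -> 0 < k -> k <= p ->
  Sset n Y k N <-> 0 < mu N (inZp k).
Proof.
move=> N0 k0 kp.
have E m : rowof (inZp k : 'I_n.+1) m = p * m + k.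
  rewrite /rowof -val_eqE /=; move: kp; rewrite leq_eqVlt => /orP[/eqP ->|kp].
    by rewrite modnn.
  by rewrite modn_small // eqn0Ngt k0.
rewrite row_len_wallP //; split=> [[m _ <-]|[m <-]]; exists m => //.
  by rewrite E.
by rewrite -E.
Qed.

Lemma tail_gt0P N : 0 < N ->
  0 < tail B mu N <-> exists e, 0 < mu (N * p ^ e) ord0.
Proof.
move=> N0; split=> [|[e mue]].
  rewrite lt0n sum_nat_eq0 negb_forall => /existsP[e].
  by rewrite negb_imply /= -lt0n => mue; exists e.
have eB : e < B.
  rewrite ltnNge; apply: contraTN mue => Be; rewrite mu_supp //.
  rewrite (leq_trans (leq_ltn_trans Be (ltn_expl e p_gt1))) ?orbT //.
  by rewrite leq_pmull.
by rewrite /tail (bigD1 (Ordinal eB)) //= addn_gt0 mue.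
Qed.

Lemma row_len_multiple L : 0 < L ->
  0 < mu L ord0 <-> exists m, row_len Y (p * m.+1) = L.
Proof.
move=> L0; rewrite row_len_wallP //.
by split=> -[m mL]; exists m; rewrite -mL /rowof eqxx mulnS addnC.
Qed.

(** The lengths entering M here are p^(s+e+1) t, so M is positive exactly when some row of class 0
    has q_m = t and p_m = s + e + 1 for some e. *)
Lemma tail_pow_gt0P t s : 0 < t -> ~~ (p %| t) ->
  0 < tail B mu (p * (p ^ s * t)) <-> exists2 m, qcof n Y m = t & s < pexp n Y m.
Proof.
move=> t0 pt; have x0 e : 0 < p ^ e * t by rewrite muln_gt0 expn_gt0.
rewrite tail_gt0P ?muln_gt0 ?expn_gt0 //.
have E e : p * (p ^ s * t) * p ^ e = p ^ (s + e.+1) * t.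
  by rewrite addnS expnS expnD mulnAC !mulnA [_ * p ^ e]mulnC; lia.
split=> [[e]|[m mt sm]].
  rewrite E row_len_multiple // => -[m mE]; exists m.
    by rewrite /qcof mE; have [] := nexp_ncof_uniq p_gt1 (s + e.+1) pt.
  rewrite /pexp mE; have [-> _] := nexp_ncof_uniq p_gt1 (s + e.+1) pt.
  by rewrite addnS ltnS leq_addr.
exists (pexp n Y m - s.+1); rewrite E addnS -addSn subnKC // row_len_multiple //.
exists m; have L0 : 0 < row_len Y (p * m.+1).
  by rewrite lt0n; apply: contraTneq sm => L0; rewrite /pexp L0 nexp0.
by rewrite -mt; exact: (nexp_ncof p_gt1 L0).1.
Qed.

Lemma Qset_wall N : 0 < N -> Qset n Y N <-> 0 < tail B mu (p * N).
Proof.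
move=> N0; have [NE pt] := nexp_ncof p_gt1 N0.
have t0 : 0 < ncof p N by case: (ncof p N) pt => //; rewrite dvdn0.
rewrite [in p * N]NE tail_pow_gt0P //; split=> [[[m _ [s /= sm sE]]|/= N00]|[m mt sm]].
- have q0 : ~~ (p %| qcof n Y m).
    have L0 : 0 < row_len Y (p * m.+1).
      by rewrite lt0n; apply: contraTneq sm => L0; rewrite /pexp L0 nexp0.
    by have [] := nexp_ncof p_gt1 L0.
  have [e1 e2] := nexp_ncof_uniq p_gt1 s q0; rewrite sE in e1 e2.
  by exists m; rewrite ?e1 ?e2.
- by rewrite N00 in N0.
by left; exists m => //; exists (nexp p N) => //; rewrite mt -NE.
Qed.

Lemma card_Sset_wall k : 0 < k -> k <= p ->
  #|` fset_set (Sset n Y k `\` Qset n Y)| =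
  \sum_(N < B.+1) (0 < mu N (inZp k)) && (tail B mu (p * N) == 0).
Proof.
move=> k0 kp.
pose P N := (0 < mu N (inZp k)) && (tail B mu (p * N) == 0).
have -> : Sset n Y k `\` Qset n Y = [set` [fset N in [seq N <- iota 0 B.+1 | P N]]%fset].
  apply/seteqP; split=> N; rewrite /setD /mkset in_fset_iota.
    (* As 0 lies in Q(Y), only positive lengths remain. *)
    move=> [SN QN]; have N0 : 0 < N by rewrite lt0n; apply/eqP => N0; apply: QN; right.
    move/(Sset_wall N0 k0 kp): (SN) => muN; rewrite /P muN /=; apply/andP; split.
      by rewrite eqn0Ngt; apply/negP => /(Qset_wall N0).
    rewrite ltnS leqNgt.
    by apply: contraTN muN => BN; rewrite mu_supp ?BN ?orbT.
  move=> /andP[/andP[muN tN] _].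
  have N0 : 0 < N by case: (N) muN => //; rewrite mu_supp.
  by split; [apply/Sset_wall | move/(Qset_wall N0); rewrite (eqP tN)].
by rewrite set_fsetK card_fset_iota.
Qed.

(** The maximum of the p_m with q_m = t is the number of s below it, and these are the s with M(pN)
    > 0 at N = p^s t. Summing over t runs through all N > 0. *)
Lemma Pstat_wall : Pstat n Y = \sum_(N < B.+1) (0 < tail B mu (p * N)).
Proof.
rewrite /Pstat.
pose g t := \big[maxn/0]_(m \in [set m | qcof n Y m = t]) pexp n Y m.
have gP t s : 0 < t -> ~~ (p %| t) -> (s < g t) = (0 < tail B mu (p * (p ^ s * t))).
  move=> t0 pt; apply/idP/idP.
    by move/(ltn_fsbig_max _ _ (finite_pexp_supp n Y))=> h; apply/tail_pow_gt0P.
  by move/(tail_pow_gt0P s t0 pt) => h; apply/(ltn_fsbig_max _ _ (finite_pexp_supp n Y)).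
have tail_bound N : 0 < tail B mu (p * N) -> N <= B.
  move=> tN; rewrite leqNgt; apply: contraTN tN => BN; rewrite tail_large //.
  by rewrite (leq_trans BN) // leq_pmull.
have g0 t : 0 < t -> ~~ (p %| t) -> B < t -> g t = 0.
  move=> t0 pt Bt; apply/eqP; rewrite -leqn0 leqNgt gP // expn0 mul1n.
  by apply: contraTN Bt => /tail_bound; rewrite leqNgt.
have gE t : 0 < t -> ~~ (p %| t) ->
    g t = \sum_(N < B.+1 | (0 < N) && (ncof p N == t)) (0 < tail B mu (p * N)).
  move=> t0 pt.
  pose P N := [&& 0 < N, ncof p N == t & 0 < tail B mu (p * N)].
  have -> : \sum_(N < B.+1 | (0 < N) && (ncof p N == t)) (0 < tail B mu (p * N)) =
      \sum_(N < B.+1) P N.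
    by rewrite big_mkcond; apply: eq_bigr => N _; rewrite /P andbA; case: (_ && (ncof p N == t)).
  rewrite -card_fset_iota.
  have -> : [fset N in [seq N <- iota 0 B.+1 | P N]]%fset =
      [fset p ^ s * t | s in iota 0 (g t)]%fset.
    apply/fsetP => N; rewrite in_fset_iota /P.
    apply/andP/imfsetP => /= [[/and3P[N0 /eqP Nt tN] _]|[s]].
      have [NE _] := nexp_ncof p_gt1 N0; rewrite Nt in NE.
      by exists (nexp p N); rewrite // mem_iota add0n gP // -NE.
    rewrite mem_iota add0n gP // => /= ts ->; have [_ ->] := nexp_ncof_uniq p_gt1 s pt.
    by split; [rewrite ts eqxx muln_gt0 t0 expn_gt0 | rewrite ltnS tail_bound].
  rewrite card_imfset /=; first by rewrite undup_id ?iota_uniq // size_iota.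
  by move=> s s' /eqP; rewrite eqn_pmul2r // => /eqP/(expnI p_gt1).
pose r := [seq t <- iota 0 B.+1 | (1 <= t) && ~~ (p %| t)].
rewrite (fsbigE r) ?filter_uniq ?iota_uniq //; first last.
- move=> t /andP[t0 pt]; rewrite mem_filter t0 pt mem_iota /= add0n -leqNgt; exact: g0.
- by move=> t /=; rewrite mem_filter => /andP[].
rewrite big_filter_cond (_ : iota 0 B.+1 = index_iota 0 B.+1) ?big_mkord; last first.
  by rewrite /index_iota subn0.
rewrite (eq_bigl (fun t : 'I_B.+1 => (0 < t) && ~~ (p %| t))) => [|t]; last first.
  by rewrite andb_idr // => tP; exact: mem_set.
rewrite (eq_bigr (fun t : 'I_B.+1 => \sum_(N < B.+1 | (0 < N) && (ncof p N == t))
    (0 < tail B mu (p * N)))) => [|t /andP[]]; last exact: gE.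
rewrite (exchange_big_dep xpredT) //=; apply: eq_bigr => N _.
have [->|N0] := posnP N; first by rewrite muln0 tail0 // big1.
have [NE pt] := nexp_ncof p_gt1 N0.
have t0 : 0 < ncof p N by case: (ncof p N) pt => //; rewrite dvdn0.
have tB : ncof p N < B.+1 by rewrite (leq_ltn_trans _ (ltn_ord N)) // leq_div.
rewrite (big_pred1 (Ordinal tB)) // => t; rewrite /= -val_eqE /= eq_sym.
by case: eqP => [->|]; rewrite ?andbF // t0 pt.
Qed.

Lemma Nstat_wall : Nstat n Y =
  \sum_(N < B.+1) if 0 < tail B mu (p * N) then n else \sum_j (0 < mu N j : nat).
Proof.
rewrite /Nstat Pstat_wall big_add1 big_mkord.
pose F j := \sum_(N < B.+1) (0 < mu N j) && (tail B mu (p * N) == 0).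
rewrite (eq_bigr (fun k : 'I_n.+1 => F (inZp k.+1))) => [|k _]; last first.
  by rewrite card_Sset_wall.
have inj : injective (fun k : 'I_n.+1 => inZp k.+1 : 'I_n.+1).
  by move=> k k'; rewrite -(addn1 k) -(addn1 k') !inZpD => /addIr; rewrite !inZp_ord.
rewrite -(reindex_inj (P := xpredT) (F := F) inj) /F exchange_big /=.
rewrite big_distrr -big_split; apply: eq_bigr => N _ /=.
case: (tail B mu (p * N)) => [|x] /=; last first.
  by rewrite muln1 big1 ?addn0 // => j _; rewrite andbF.
by rewrite muln0 add0n; apply: eq_bigr => j _; rewrite andbT.
Qed.

End WallStatistic.

(** * Expansion of the product *)

Section EqualUpTo.
Variables (n : nat) (R : comNzRingType) (d : nat).
Implicit Types f g : mfps n R.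

Definition eq_upto f g := forall m, (mdeg m <= d)%N -> f m = g m.

Lemma eq_uptoM f f' g g' : eq_upto f f' -> eq_upto g g' -> eq_upto (f * g) (f' * g').
Proof.
move=> ef eg m md; apply: mfps_coefM_eq => k km.
  by apply: ef; apply: leq_trans md.
by apply: eg; apply: leq_trans md.
Qed.

Lemma eq_upto_prod (I : eqType) (r : seq I) (P : pred I) (F G : I -> mfps n R) :
  (forall x, x \in r -> P x -> eq_upto (F x) (G x)) ->
  eq_upto (\prod_(x <- r | P x) F x) (\prod_(x <- r | P x) G x).
Proof.
elim: r => [|x r IH] FG; first by rewrite !big_nil.
have IH' := IH (fun y yr => FG y (mem_behead (s := x :: r) yr)).
rewrite !big_cons; case: ifP => // Px.
by apply: eq_uptoM => //; apply: FG; rewrite ?mem_head.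
Qed.

Lemma eq_uptoX f g k : eq_upto f g -> eq_upto (f ^+ k) (g ^+ k).
Proof.
by move=> fg; elim: k => [|k IH]; rewrite ?expr0 // !exprS; apply: eq_uptoM.
Qed.

End EqualUpTo.

Section Monomials.
Variables (n : nat) (R : comNzRingType).
Implicit Types m : 'X_{1..n.+1}.

Definition mono m : mfps n.+1 R := zexp R (rootlat_of_mnm m).

Lemma monoE m k : mono m k = (k == m)%:R.
Proof. by rewrite /mono /zexp (inj_eq (@rootlat_of_mnm_inj n)). Qed.

Lemma mono0 : mono 0%MM = 1.
Proof. by apply: funext => k; rewrite monoE mfps_coef1. Qed.

Lemma monoD m m' : mono (m + m')%MM = mono m * mono m'.
Proof.
rewrite /mono -zexpD; congr zexp; apply/ffunP => i.
by rewrite !ffunE mnmDE PoszD.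
Qed.

Lemma monoX m k : mono m ^+ k = mono (m *+ k)%MM.
Proof.
elim: k => [|k IH].
  by rewrite expr0 -mono0; congr mono; apply/mnmP => i; rewrite mulmnE muln0 mnm0E.
by rewrite exprS IH -monoD; congr mono; apply/mnmP => i; rewrite mnmDE !mulmnE mulnS.
Qed.

Lemma mono_prod (I : finType) (P : pred I) (F : I -> 'X_{1..n.+1}) :
  \prod_(x | P x) mono (F x) = mono [multinom (\sum_(x | P x) F x i)%N | i < n.+1].
Proof.
transitivity (mono (\big[mnm_add/mnm0]_(x | P x) F x)).
  by apply/esym/big_morph; [exact: monoD | exact: mono0].
by congr mono; apply/mnmP => i; rewrite mnmE mnm_sumE.
Qed.

End Monomials.

Section Product.
Variables (R : comUnitRingType) (q : R) (n : nat).
Hypothesis n_gt0 : (0 < n)%N.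
Implicit Types (m : 'X_{1..n.+1}) (d : nat).

Definition root_factor (a : rootlat n) : mfps n.+1 R :=
  (1 - q^-1 *: zexp R a) / (1 - zexp R a).

(** Multiplying the sum by 1 - x gives 1 - q^-1 x up to the term (1 - q^-1) x^(d+1), invisible in
    degrees at most d. The exponent [(0 < k)] puts one factor 1 - q^-1 on each k > 0. *)
Lemma root_factor_expand d m : (0 < mdeg m)%N -> 1 - mono R m \is a GRing.unit ->
  eq_upto d (root_factor (rootlat_of_mnm m))
    (\sum_(k < d.+1) (1 - q^-1) ^+ (0 < k)%N *: mono R (m *+ k)%MM).
Proof.
move=> m0 um; rewrite /root_factor -/(mono R m); set x := mono R m.
set E := \sum_(k < _) _.
have x0 : x 0%MM = 0.
  by rewrite /x monoE; case: eqP => // e; move: m0; rewrite -e mdeg0.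
have EE : E * (1 - x) = 1 - q^-1 *: x - (1 - q^-1) *: x ^+ d.+1.
  have -> : E = 1 + (1 - q^-1) *: (x * \sum_(k < d) x ^+ k).
    rewrite /E big_ord_recl expr0 scale1r -monoX expr0; congr (_ + _).
    rewrite mulr_sumr scaler_sumr; apply: eq_bigr => k _.
    by rewrite -monoX lift0 expr1 exprS.
  have geo : (\sum_(k < d) x ^+ k) * (1 - x) = 1 - x ^+ d.
    by rewrite mulrC -(opprB x 1) mulNr -subrX1 opprB.
  rewrite mulrDl mul1r -scalerAl -mulrA geo mulrBr mulr1 -exprS scalerBr scalerBl scale1r.
  by rewrite !addrA subrK.
move=> k kd; rewrite -[E](mulrK um) EE.
apply: (eq_uptoM (d := d)) => // l ld.
by rewrite [in RHS]mfps_coefB mfps_coefZ mfps_coefX_small ?mulr0 ?subr0.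
Qed.

Lemma rootv_unit N j : (0 < N)%N -> 1 - mono R (segm N j : 'X_{1..n.+1}) \is a GRing.unit.
Proof. by move=> N0; apply: unit_1_sub_zexp; apply: pos_root_rootv. Qed.

Lemma root_factor_large d N j : (d < N)%N ->
  eq_upto d (root_factor (rootv N j)) 1.
Proof.
move=> dN; have N0 : (0 < N)%N by apply: leq_trans dN.
have md : (0 < mdeg (segm N j : 'X_{1..n.+1}))%N by rewrite mdeg_segm.
move=> k kd; rewrite (root_factor_expand (d := d) md (rootv_unit j N0)) // mfps_coef_sum.
rewrite big_ord_recl big1 ?addr0 => [|i _].
  rewrite mfps_coefZ expr0 mul1r -monoX expr0 //.
rewrite mfps_coefZ monoE; case: eqP => [e|]; rewrite ?mulr0 //.
move: kd; rewrite e mdegMn mdeg_segm lift0 mulnS leqNgt.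
by rewrite (leq_trans dN) // leq_addr.
Qed.

Section Truncated.
Variable d : nat.

Definition kidx : pred ('I_d.+1 * 'I_n.+1) := fun x => Kidx x.1 x.2.

Definition low_roots : {fset rootlat n} :=
  [fset rootv x.1 x.2 | x : ('I_d.+1 * 'I_n.+1)%type in kidx]%fset.

(** A Kostant partition of total degree at most d has lengths and multiplicities at most d, so
    finite functions suffice. *)
Definition kfun := {ffun 'I_d.+1 * 'I_n.+1 -> 'I_d.+1}.

Definition kweight (g : kfun) : 'X_{1..n.+1} :=
  [multinom (\sum_x g x * seg x.1 x.2 i)%N | i < n.+1].

Lemma mem_low_roots N (j : 'I_n.+1) : (0 < N)%N ->
  (rootv N j \in low_roots) = (N <= d)%N.
Proof.
move=> N0; apply/imfsetP/idP => [[[N' j'] /= _ /rootv_height ->]|Nd].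
  by rewrite -ltnS.
have : (0 < #|[pred k | Kidx N k && (rootv N k == rootv N j)]|)%N.
  by rewrite -root_multE // /root_mult; case: asboolP.
case/card_gt0P => k; rewrite inE => /andP[kk /eqP <-].
by exists (Ordinal (Nd : (N < d.+1)%N), k).
Qed.

(** Group the pairs (N, j) by the root they weigh; by [root_multE] each group has as many members as
    the multiplicity. *)
Lemma prod_low_roots (G : rootlat n -> mfps n.+1 R) :
  \prod_(a <- low_roots) G a ^+ root_mult a = \prod_(x | kidx x) G (rootv x.1 x.2).
Proof.
have -> : \prod_(x | kidx x) G (rootv x.1 x.2) =
    \prod_(a <- low_roots) \prod_(x | kidx x && (rootv x.1 x.2 == a)) G (rootv x.1 x.2).
  rewrite (exchange_big_dep kidx) //=; last by move=> a x _ /andP[].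
  apply: eq_bigr => x kx.
  have xl : rootv x.1 x.2 \in low_roots by apply/imfsetP; exists x.
  rewrite big_mkcond (bigD1_seq _ xl) ?fset_uniq //= kx eqxx big1 ?mulr1 // => a ax.
  by rewrite eq_sym (negbTE ax).
rewrite big_seq [RHS]big_seq; apply: eq_bigr => a /imfsetP[[N j] /= kj ->].
have N0 : (0 < N)%N by case/andP: kj.
rewrite (eq_bigr (fun=> G (rootv N j))) => [|x /andP[_ /eqP->] //].
rewrite prodr_const root_multE //; congr (_ ^+ _).
rewrite -(card_imset (f := fun k : 'I_n.+1 => (N, k)) (mem [pred k | _])) => [|k k' []//].
apply: eq_card => -[N' k]; rewrite -[RHS]/(kidx (N', k) && (rootv N' k == rootv N j)).
apply/imsetP/andP => /= [[k' + [-> ->]]|[kk /eqP e]]; last first.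
  have e' : N' = N by apply: val_inj; exact: rootv_height e.
  by rewrite {}e' in kk e *; exists k => //; rewrite unfold_in /= e eqxx andbT.
by rewrite unfold_in => /andP[].
Qed.

Lemma prod_kidx_expand m : (mdeg m <= d)%N ->
  (\prod_(x | kidx x) root_factor (rootv x.1 x.2)) m =
  \sum_(g in pfamily ord0 kidx (fun=> xpredT) | kweight g == m)
    (1 - q^-1) ^+ (\sum_x (0 < g x))%N.
Proof.
move=> md.
transitivity ((\prod_(x | kidx x)
   \sum_(k < d.+1) (1 - q^-1) ^+ (0 < k)%N *: mono R (segm x.1 x.2 *+ k)%MM) m).
  apply: (eq_upto_prod (d := d)) => // x _ kx; apply: root_factor_expand.
    by rewrite mdeg_segm; case/andP: kx.
  by apply: rootv_unit; case/andP: kx.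
(* Distributing picks an exponent g x in every factor; [pfamily] keeps g at 0 outside [kidx]. *)
rewrite (big_distr_big_dep ord0) mfps_coef_sum [RHS]big_mkcondr.
apply: eq_bigr => g /pfamilyP[gs _].
have g0 x : ~~ kidx x -> g x = ord0.
  by move=> kx; apply/eqP; apply: contraNT kx => /(fintype.subsetP gs).
rewrite scaler_prod mono_prod mfps_coefZ monoE prodrXr eq_sym.
have -> : (\sum_(x | kidx x) (0 < g x) = \sum_x (0 < g x))%N.
  by rewrite big_mkcond; apply: eq_bigr => x _; case: ifPn => // /g0 ->.
have -> : [multinom (\sum_(x | kidx x) (segm x.1 x.2 *+ g x)%MM i)%N | i < n.+1] = kweight g.
  apply/mnmP => i; rewrite !mnmE big_mkcond; apply: eq_bigr => x _.
  by rewrite mulmnE mnmE mulnC; case: ifPn => // /g0 ->.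
by case: eqP; rewrite ?mulr1 ?mulr0.
Qed.

End Truncated.

End Product.

(** * Kostant partitions and walls of a given weight *)

Section WallWeight.
Local Open Scope nat_scope.
Variable n : nat.
Implicit Types Y : {fset site}.

Lemma wtE Y :
  (- wt n Y)%R = rootlat_of_mnm [multinom color_count Y i | i < n.+1].
Proof.
rewrite /wt opprK; apply/ffunP => i; rewrite [RHS]ffunE mnmE sum_ffunE.
rewrite (bigD1 i) //= big1 ?addr0 => [|k ki]; rewrite ffunMnE ffunE.
  by rewrite eqxx -natz.
by rewrite eq_sym (negbTE ki) mul0rn.
Qed.

Lemma card_color_count Y : #|` Y| = \sum_(i < n.+1) color_count Y i.
Proof.
under eq_bigr do rewrite /color_count card_fset_sep.
rewrite exchange_big card_fset_sum1; apply: eq_bigr => s _ /=.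
by rewrite (bigD1 (color n s)) //= eqxx big1 // => i; rewrite eq_sym => /negbTE ->.
Qed.

Lemma column_le_card Y s : is_gyw Y -> s \in Y -> s.2 <= #|` Y|.
Proof.
case: s => k c gY kY; have [/= k0 _] := andP (gY.1 _ kY).
have := kY; rewrite (mem_row c gY k0) => /andP[_ /leq_trans]; apply.
by apply: fsubset_leq_card; apply/fsubsetP => s; rewrite !inE => /andP[].
Qed.

End WallWeight.

Section KostantWalls.
Local Open Scope nat_scope.
Variable n : nat.
Hypothesis n_gt0 : 0 < n.
Variable m : 'X_{1..n.+1}.
Local Notation p := n.+1.
Local Notation d := (mdeg m).
Local Notation B := (p * d).

Definition kost_fun : pred (kfun n d) :=
  fun g => (g \in pfamily ord0 (@kidx n d) (fun=> xpredT)) && (kweight g == m).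

Definition kext (g : kfun n d) (N : nat) (j : 'I_n.+1) : nat :=
  if insub N is Some N' then g (N', j) else 0.

Definition kost_wall (g : kfun n d) : {fset site} :=
  wall B (of_kostant (kext g)).

Lemma kext_ord g (N : 'I_d.+1) j : kext g N j = g (N, j).
Proof. by rewrite /kext valK. Qed.

Lemma kext_large g N j : d < N -> kext g N j = 0.
Proof. by move=> dN; rewrite /kext insubF // ltnS leqNgt dN. Qed.

Lemma leq_dB : d <= B. Proof. by rewrite leq_pmull. Qed.

Lemma sum_kext (g : kfun n d) (F : nat -> 'I_n.+1 -> nat -> nat) :
  (forall N j, F N j 0 = 0) ->
  \sum_(N < B.+1) \sum_j F N j (kext g N j) =
  \sum_(x : ('I_d.+1 * 'I_n.+1)%type) F x.1 x.2 (g x).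
Proof.
move=> F0; transitivity (\sum_(N < d.+1) \sum_j F N j (g (N, j))); last first.
  by rewrite pair_bigA; apply: eq_bigr => -[].
rewrite -(big_mkord xpredT (fun N => \sum_j F N j (kext g N j))).
rewrite (big_cat_nat (n := d.+1)) //= ?ltnS ?leq_dB //.
rewrite [X in _ + X]big1_seq ?addn0 => [|N]; last first.
  rewrite mem_index_iota => /and3P[_ dN _]; apply: big1 => j _.
  by rewrite kext_large.
by rewrite big_mkord; apply: eq_bigr => N _; apply: eq_bigr => j _; rewrite kext_ord.
Qed.

Section OfKostFun.
Variable g : kfun n d.
Hypothesis gK : kost_fun g.

Lemma kost_fun0 x : ~~ kidx x -> g x = ord0.
Proof.
have /andP[/pfamilyP[gs _] _] := gK.
by move=> kx; apply/eqP; apply: contraNT kx => /(fintype.subsetP gs).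
Qed.

Lemma kext_supp N j : (N == 0) || (d < N) -> kext g N j = 0.
Proof.
case/orP=> [/eqP ->|]; last exact: kext_large.
by rewrite -[0]/(nat_of_ord (ord0 : 'I_d.+1)) kext_ord kost_fun0.
Qed.

Lemma kext_kostant : kostant (kext g).
Proof.
move=> N pN; have [dN|Nd] := ltnP d N; first exact: kext_large.
rewrite -[N]/(nat_of_ord (Ordinal (Nd : N < d.+1))) kext_ord kost_fun0 //.
by rewrite /kidx /Kidx /= pN /= andbF.
Qed.

Let mu := of_kostant (kext g).

Lemma kost_mu_supp : supported B mu.
Proof. exact: (of_kostant_supported n_gt0 (leqnn B) kext_supp). Qed.

Lemma kost_mu_aper : aperiodic mu.
Proof. exact: of_kostant_aperiodic. Qed.

Lemma kost_muK : to_kostant B mu = kext g.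
Proof.
apply: funext => N; apply: funext => j.
exact: (of_kostantK n_gt0 (leqnn B) kext_supp kext_kostant).
Qed.

Lemma kost_wall_Yinf : Yinf n (kost_wall g).
Proof. exact: wall_Yinf kost_mu_supp kost_mu_aper. Qed.

Lemma kost_wall_wt : (- wt n (kost_wall g))%R = rootlat_of_mnm m.
Proof.
rewrite wtE; congr rootlat_of_mnm; have /andP[_ /eqP <-] := gK.
apply/mnmP => i; rewrite !mnmE color_count_wall; last exact: kost_mu_supp.
rewrite -(to_kostant_weight n_gt0 kost_mu_supp).
by rewrite kost_muK (sum_kext g (F := fun N j x => x * seg N j i)) // => N j; rewrite mul0n.
Qed.

Lemma kost_wall_Nstat : Nstat n (kost_wall g) = \sum_x (0 < g x).
Proof.
rewrite (Nstat_wall n_gt0 kost_mu_supp) -(to_kostant_count n_gt0 kost_mu_supp).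
by rewrite kost_muK (sum_kext g (F := fun N j x => 0 < x : nat)).
Qed.

End OfKostFun.

(** A wall gives back mu through [row_mult], and mu gives back the partition through
    [to_kostant]. *)
Lemma kost_wall_inj : {in kost_fun &, injective kost_wall}.
Proof.
move=> g g' gK gK' e; apply/ffunP => -[N j]; apply: val_inj.
rewrite /= -!kext_ord -(kost_muK gK) -(kost_muK gK').
congr (to_kostant B _ N j).
apply: funext => k; apply: funext => i.
rewrite -(row_multK k i (kost_mu_supp gK)) -(row_multK k i (kost_mu_supp gK')).
by congr (row_mult _ k i).
Qed.

Lemma kost_wall_surj Y : Yinf n Y -> (- wt n Y)%R = rootlat_of_mnm m ->
  exists2 g, g \in kost_fun & kost_wall g = Y.
Proof.
move=> YY; have [gY pY rY] := YY; rewrite wtE => /rootlat_of_mnm_inj/mnmP mE.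
have mY i : color_count Y i = m i by rewrite -mE mnmE.
have cardY : #|` Y| = d by rewrite mdegE (card_color_count n); apply: eq_bigr.
have YB s : s \in Y -> s.2 <= B.
  by move=> sY; rewrite (leq_trans (column_le_card gY sY)) // cardY leq_dB.
pose mu := row_mult (n := n) Y; have mus : supported B mu := row_mult_supported YB.
have mua : aperiodic mu := row_mult_aperiodic rY.
pose c := to_kostant B mu.
have cw i : \sum_(N < B.+1) \sum_j c N j * seg N j i = m i.
  by rewrite (to_kostant_weight n_gt0 mus) -color_count_wall // row_multY.
have cs : supported B c := to_kostant_supported mus.
(* The c(N, j) segments of length N use c(N, j) N boxes out of d, so nonzero entries have N <= d and
   c(N, j) <= d, and [kfun] can hold them. *)
have cd N j : c N j * N <= d.
  have [NB|BN] := leqP N B; last by rewrite cs ?BN ?orbT.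
  have lt : N < B.+1 by [].
  rewrite mdegE -[X in _ * X](sum_seg N j) big_distrr /=; apply: leq_sum => i _.
  by rewrite -cw (bigD1 (Ordinal lt)) //= (bigD1 j) //= -addnA leq_addr.
have c_le N j : c N j <= d.
  have [->|N0] := posnP N; first by rewrite cs.
  by rewrite (leq_trans _ (cd N j)) // leq_pmulr.
have c_large N j : d < N -> c N j = 0.
  move=> dN; apply/eqP; rewrite -leqn0 leqNgt; apply/negP => c0.
  by have := leq_trans (leq_pmull N c0) (cd N j); rewrite leqNgt dN.
pose g : kfun n d := [ffun x : 'I_d.+1 * 'I_n.+1 => inord (c x.1 x.2)].
have gc : kext g = c.
  apply: funext => N; apply: funext => j; have [dN|Nd] := ltnP d N.
    by rewrite kext_large // c_large.
  rewrite -[N]/(nat_of_ord (Ordinal (Nd : N < d.+1))) kext_ord ffunE inordK //.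
  by rewrite ltnS.
exists g.
  apply/andP; split.
    apply/pfamilyP; split=> //; apply/fintype.subsetP => -[N j]; rewrite !inE.
    apply: contraR => kN; apply/eqP/val_inj; rewrite /= -kext_ord gc.
    move: kN; rewrite /kidx unfold_in /Kidx /= negb_and negbK -eqn0Ngt.
    case/orP => [N0|/andP[pN /eqP ->]]; first by rewrite cs ?N0.
    by rewrite /c (to_kostant_kostant).
  apply/eqP/mnmP => i; rewrite mnmE -cw -gc.
  by rewrite (sum_kext g (F := fun N j x => x * seg N j i)) // => N j; rewrite mul0n.
rewrite /kost_wall gc -(row_multY YY YB); congr (wall B _).
by apply: funext => N; apply: funext => j; apply: to_kostantK.
Qed.

End KostantWalls.

Theorem theorem3p23 (R : comUnitRingType) (q : R) (n : nat) :
  q \is a GRing.unit -> (1 <= n)%N ->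
  exists f : mfps n.+1 R,
    has_mfprod (@pos_root n)
      (fun a => ((1 - q^-1 *: zexp R a) / (1 - zexp R a)) ^+ root_mult a) f /\
    has_mfsum (@Yinf n)
      (fun Y => (1 - q^-1) ^+ Nstat n Y *: zexp R (- wt n Y)) f.
Proof.
move=> _ n_gt0.
exists (fun m => \sum_(g | kost_fun (m := m) g) (1 - q^-1) ^+ (\sum_x (0 < g x))%N).
split=> m; last first.
  (* Exactly the walls with -wt(Y) = m contribute to the coefficient at m, and these are the images
     of the Kostant partitions of m. *)
  pose J0 := [fset Y in [seq kost_wall g | g in @kost_fun n m]]%fset.
  have J0P Y : Y \in J0 -> exists2 g : kfun n (mdeg m), kost_fun (m := m) g & Y = kost_wall g.
    by rewrite in_fset => /mapP[g]; rewrite mem_enum => gK ->; exists g.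
  exists J0 => [Y /J0P[g gK ->]|J J0J JY]; first exact: kost_wall_Yinf.
  rewrite mfps_coef_sum -(big_fset_incl _ J0J) /= => [|Y YJ YJ0]; last first.
    rewrite mfps_coefZ /zexp; case: eqP => [e|]; rewrite ?mulr0 //.
    have [g gK gY] := kost_wall_surj n_gt0 (JY _ YJ) (esym e).
    case/negP: YJ0; rewrite -gY in_fset; apply/mapP; exists g => //.
    by rewrite mem_enum.
  have pe : perm_eq J0 [seq kost_wall g | g in @kost_fun n m].
    apply: uniq_perm; [exact: fset_uniq | | by move=> Y; rewrite in_fset].
    rewrite map_inj_in_uniq ?enum_uniq // => g g'; rewrite !mem_enum.
    exact: kost_wall_inj.
  rewrite (perm_big _ pe) /= big_map big_enum /=.
  apply: eq_bigr => g gK; rewrite mfps_coefZ /zexp kost_wall_wt // eqxx mulr1.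
  by rewrite kost_wall_Nstat.
(* Roots of height above the degree of m have factors equal to 1 up to that degree, so the product
   is already stable at [low_roots]. *)
exists (low_roots n (mdeg m)) => [a /imfsetP[[N j] /= kj ->]|J J0J Jpos].
  by apply: pos_root_rootv; case/andP: kj.
rewrite (big_fsetID _ (mem (low_roots n (mdeg m)))) /=.
have -> : [fset a in J | a \in low_roots n (mdeg m)]%fset = low_roots n (mdeg m).
  by apply/fsetP => a; rewrite !inE andb_idl // => /(fsubsetP J0J).
transitivity ((\prod_(a <- low_roots n (mdeg m)) root_factor q a ^+ root_mult a * 1) m).
  apply: (eq_uptoM (d := mdeg m)) => //.
  have e1 : \prod_(a <- [fset x in J | x \notin low_roots n (mdeg m)]%fset) 1 = 1 :> mfps n.+1 R.
    by rewrite big1_eq.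
  rewrite -[X in eq_upto _ _ X]e1.
  apply: eq_upto_prod => a; rewrite !inE => /andP[aJ al] _.
  have [N [j [N0 aE]]] := pos_rootP (Jpos _ aJ).
  rewrite -[X in eq_upto _ _ X](expr1n _ (root_mult a)); apply: eq_uptoX.
  rewrite aE; apply: root_factor_large.
  by rewrite ltnNge -(mem_low_roots n_gt0 _ j N0) -aE.
by rewrite mulr1 prod_low_roots prod_kidx_expand.
Qed.
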